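(* Let $(L,A)$ be an SH Lie pair with $B=L/A$ and let $E$ be an $A$-module. If two $A$-compatible infinitesimal deformations $Q(\hbar)=Q_L+\hbar Q_+$ and $\bar Q(\hbar)=Q_L+\hbar\bar Q_+$ of $Q_L$ are gauge equivalent, then the two associated Atiyah classes are the same: $$[\alpha^{E[\hbar]}]=[\overline{\alpha^{E[\hbar]}}]\in \mathrm{H}^2_{\mathrm{CE}}(A[\hbar],(B[\hbar])^\vee\otimes\mathrm{End}(E[\hbar]))\cong \mathrm{H}^2_{\mathrm{CE}}(A,B^\vee\otimes\mathrm{End}(E))[\hbar].$$
   Context: Conventions. $\mathbb{K}$ is a field of characteristic zero; graded means $\mathbb{Z}$-graded; $V^\vee$ is the graded dual, $(V^\vee)^n=(V^{-n})^*$; graded vector spaces whose duals are used are finite-dimensional. $\mathcal{O}(V)=\prod_{n\ge 0}S^n(V^\vee)$ is the algebra of formal power series on $V$ (completed graded symmetric algebra, product formed degree by degree), with product $\odot$. Elements of $\mathcal{O}(V)\otimes\mathrm{End}(E)$ are regarded as $\mathcal{O}(V)$-linear maps by $(\omega\otimes\phi)(\eta\otimes e)=(-1)^{|\phi||\eta|}\omega\odot\eta\otimes\phi(e)$; $[-,-]$ is the graded commutator; the Koszul sign rule is used throughout. SH Lie pairs. An $L_\infty[1]$-algebra is a graded vector space $L$ with a degree $1$ derivation $Q_L$ of $\mathcal{O}(L)$ with $Q_L^2=0$ (equivalently, degree $1$ brackets $\lambda_k:S^k(L)\to L$, $k\ge0$, satisfying the generalized Jacobi identities). An SH Lie pair $(L,A)$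 is an $L_\infty[1]$-algebra $L$ with an $L_\infty[1]$-subalgebra $A\subset L$ (closed under all $\lambda_k$, $k\ge 0$). With $j:A\to L$ the inclusion and $j^\vee:\mathcal{O}(L)\to\mathcal{O}(A)$ the restriction, the homological vector field $Q_A$ of $A$ satisfies $j^\vee\circ Q_L=Q_A\circ j^\vee$. $A^\perp=\ker(j^\vee:L^\vee\to A^\vee)\cong B^\vee$. Let $I^V:\mathcal{O}(V)\to\mathcal{O}(V)\otimes V^\vee$ be given by $I^V(1)=0$, $I^V(\xi)=1\otimes\xi$ for $\xi\in V^\vee$, $I^V(\omega\odot\omega')=\omega\odot I^V(\omega')+(-1)^{|\omega||\omega'|}\omega'\odot I^V(\omega)$, and $J=(j^\vee\otimes 1)\circ I^L:\mathcal{O}(L)\to\mathcal{O}(A)\otimes L^\vee$. Modules. An $A$-module is a graded vector space $E$ with $D^{A,E}\in(\mathcal{O}(A)\otimes\mathrm{End}(E))^1$ such that $\partial_A^E=Q_A+D^{A,E}$, i.e. $\omega\otimes e\mapsto Q_A(\omega)\otimes e+(-1)^{|\omega|}\omega\odot D^{A,E}(e)$, squares to zero; $\mathrm{H}^\bullet_{\mathrm{CE}}(A,E)$ is its cohomology. $A^\perp\cong B^\vee$ is an $A$-module (dual to the canonical $A$-module $B$) with differential $Q_A+D^\perp$, $D^\perp(\xi)=J(Q_L(\xi))$ for $\xi\in A^\perp$; on $B^\vee\otimes\mathrm{End}(E)$ the differential is $Q_A+D^\perp+[D^{A,E},-]$. Deformations. $\hbar$ is a formal parameter with $\hbar^2=0$;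 all maps are extended $\mathbb{K}[\hbar]$-linearly. An infinitesimal deformation of $Q_L$ is a differential $Q(\hbar)=Q_L+\hbar Q_+$ on $\mathcal{O}(L)[\hbar]$, where $Q_+$ is a degree $1$ derivation of $\mathcal{O}(L)$ (so $[Q_L,Q_+]=0$). It is $A$-compatible if (1) $j^\vee\circ Q(\hbar)=Q_A\circ j^\vee$ on $\mathcal{O}(L)[\hbar]$ (the structure on $A$ is not deformed), and (2) $J(Q(\hbar)(\xi))=D^\perp(\xi)$ for all $\xi\in A^\perp$ (the $A$-module structure on $B$ is not deformed). A gauge equivalence of $\mathcal{O}(L)[\hbar]$ is an automorphism $\sigma=1+\hbar\lambda$ of the graded commutative algebra $\mathcal{O}(L)[\hbar]$, $\lambda:\mathcal{O}(L)\to\mathcal{O}(L)$ $\mathbb{K}$-linear, which restricts to the identity on $\mathcal{O}(B)[\hbar]\subset\mathcal{O}(L)[\hbar]$ (embedded by pullback along the projection $L\to B$) and satisfies $j^\vee\circ\sigma=j^\vee$. $Q(\hbar)$ and $\bar Q(\hbar)$ are gauge equivalent if there is such a $\sigma$ with $\sigma\circ Q(\hbar)=\bar Q(\hbar)\circ\sigma$. Associated Atiyah class. Given an $A$-compatible $Q(\hbar)$, $(L[\hbar],A[\hbar])$ is an SH Lie pair over $\mathbb{K}[\hbar]$ and $E[\hbar]$, with the $\hbar$-linearly extended structure $D^{A,E}$, is an $A[\hbar]$-module. Choose $D^{L,E}\in(\mathcal{O}(L)\otimes\mathrm{End}(E))^1[\hbar]$ with $(j^\vee\otimes1)(D^{L,E})=D^{A,E}$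 and set $\alpha^{E[\hbar]}=(J\otimes1)\big(Q(\hbar)(D^{L,E})+(D^{L,E})^2\big)$, a degree $2$ cocycle in $(\mathcal{O}(A)\otimes B^\vee\otimes\mathrm{End}(E))[\hbar]$ whose class $[\alpha^{E[\hbar]}]$ (the Atiyah class of $(L[\hbar],A[\hbar])$ with respect to $E[\hbar]$) is independent of the choice. $\overline{\alpha^{E[\hbar]}}$ denotes the analogous cocycle for $\bar Q(\hbar)$. *)

(* Defs.v *)
From HB Require Import structures.
From mathcomp Require Import all_boot all_order all_algebra.
From mathcomp Require Import boolp functions.

Set Implicit Arguments.
Unset Strict Implicit.
Unset Printing Implicit Defensive.

Import GRing.Theory.
Local Open Scope ring_scope.

(* Homogeneous elements of an int-indexed family; [tag] is the degree. *)
Definition homog (T : int -> Type) : Type := {n : int & T n}.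
Definition hel (T : int -> Type) n (x : T n) : homog T := existT T n x.

Definition koszul (K : unitRingType) (m n : int) : K := (-1) ^ (m * n).

(* The graded vector space [V] is finite-dimensional, cf. [fin_dim] below, and
   [K] has characteristic 0.  Then [S^k(V^\vee)] is the space of
   graded-symmetric [k]-linear forms on [V], with [xi_1 (.) .. (.) xi_k] acting
   by the signed sum over permutations, and the product of forms is the signed
   shuffle product.  An element [f] of [O(V)^n = \prod_k S^k(V^\vee)^n] is thus
   a function on finite words in homogeneous elements of [V]: its restriction
   to words of length [k] is its component in [S^k(V^\vee)^n], and
   [f [:: v_1; ..; v_k]] is the constant term of [d_(v_k) .. d_(v_1) f], where
   [d_v] is the left partial derivative along [v]. *)
Section FormalPowerSeries.
Variables (K : fieldType) (V : int -> vectType K).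

Definition letter : Type := homog (fun n => V n).
Definition vec n (v : V n) : letter := hel (T := fun n => V n) v.
Definition wdeg (s : seq letter) : int := \sum_(v <- s) tag v.

Local Notation series := (seq letter -> K^o).

Definition form_linear (f : series) : Prop :=
  forall s1 s2 n, linear (fun v : V n => f (s1 ++ vec v :: s2)).
Definition form_symmetric (f : series) : Prop :=
  forall s1 u v s2,
    f (s1 ++ u :: v :: s2) = koszul K (tag u) (tag v) * f (s1 ++ v :: u :: s2).
(* A form of degree [n] only pairs with words of degree [- n]. *)
Definition form_degree (n : int) (f : series) : Prop :=
  forall s, n + wdeg s != 0 -> f s = 0.

Definition is_fps (n : int) (f : series) : Prop :=
  [/\ form_linear f, form_symmetric f & form_degree n f].
Definition fps_pred (n : int) : {pred series} := fun f => `[< is_fps n f >].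

Lemma fps_predP n f : reflect (is_fps n f) (f \in fps_pred n).
Proof. exact: asboolP. Qed.

Lemma fps_submod n : submod_closed (fps_pred n).
Proof.
split=> [|a f g /fps_predP[fl fs fd] /fps_predP[gl gs gd]]; apply/fps_predP.
  split=> [s1 s2 m b u v|s1 u v s2|s _] //=; first by rewrite scaler0 addr0.
  by rewrite mulr0.
have E s : (a *: f + g) s = a * f s + g s by [].
split=> [s1 s2 m b u v|s1 u v s2|s ns]; rewrite !E.
- rewrite fl gl /GRing.scale /= !mulrDr mulrCA -!addrA; congr (_ + _).
  by rewrite addrCA.
- by rewrite fs gs mulrDr mulrCA.
- by rewrite fd ?gd // mulr0 addr0.
Qed.
HB.instance Definition _ n :=
  GRing.isSubmodClosed.Build K series (fps_pred n) (fps_submod n).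

(* [O(V)^n] *)
Record fps (n : int) := Fps { fps_val :> series; _ : fps_val \in fps_pred n }.
HB.instance Definition _ n := [isSub for @fps_val n].
HB.instance Definition _ n := [Choice of fps n by <:].
HB.instance Definition _ n := [SubChoice_isSubLmodule of fps n by <:].

(* The sum over all ways of splitting the word into a pair of subwords, fed to
   [f] and [g], with the Koszul sign of the unshuffle; equivalently, [d_v] is a
   derivation of degree [tag v]. *)
Fixpoint shuffle (f g : series) (s : seq letter) : K :=
  if s is v :: s' then
    shuffle (fun t => f (v :: t)) g s' +
    shuffle (fun t => koszul K (tag v) (wdeg t) * f t) (fun t => g (v :: t)) s'
  else f [::] * g [::].


Lemma wdeg_nil : wdeg [::] = 0. Proof. exact: big_nil. Qed.
Lemma wdeg_cons v s : wdeg (v :: s) = tag v + wdeg s.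
Proof. exact: big_cons. Qed.
Lemma wdeg_cat s t : wdeg (s ++ t) = wdeg s + wdeg t.
Proof. exact: big_cat. Qed.
Lemma wdeg_rcons s v : wdeg (rcons s v) = wdeg s + tag v.
Proof. by rewrite -cats1 wdeg_cat wdeg_cons wdeg_nil addr0. Qed.

Lemma koszulDr m n p : koszul K m (n + p) = koszul K m n * koszul K m p.
Proof. by rewrite /koszul mulrDr expfzDr // oppr_eq0 oner_eq0. Qed.
Lemma koszulC m n : koszul K m n = koszul K n m.
Proof. by rewrite /koszul mulrC. Qed.
Lemma koszulDl m n p : koszul K (m + n) p = koszul K m p * koszul K n p.
Proof. by rewrite koszulC koszulDr !(koszulC p). Qed.
Lemma koszulNr m n : koszul K m (- n) = koszul K m n.
Proof. by rewrite /koszul mulrN -exprz_inv invrN1. Qed.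
Lemma koszul_sq m n : koszul K m n * koszul K m n = 1.
Proof. by rewrite -{2}koszulNr -koszulDr subrr /koszul mulr0 expr0z. Qed.

Definition dletter (v : letter) (f : series) : series := fun t => f (v :: t).
Definition twist (n : int) (f : series) : series :=
  fun t => koszul K n (wdeg t) * f t.

Lemma shuffle_cons f g v s : shuffle f g (v :: s) =
  shuffle (dletter v f) g s + shuffle (twist (tag v) f) (dletter v g) s.
Proof. by []. Qed.

Lemma shuffle_linl a f f' g s :
  shuffle (a *: f + f') g s = a * shuffle f g s + shuffle f' g s.
Proof.
elim: s f f' g => [|v s IH] f f' g.
  by rewrite /= [(_ + _) _]/(a * f [::] + f' [::]) mulrDl mulrA.
rewrite !shuffle_cons mulrDr addrACA -!IH; congr (shuffle _ _ _ + shuffle _ _ _).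
by apply/funext => t; rewrite /twist [in LHS]/(_ + _) /= mulrDr; congr (_ + _);
  rewrite /GRing.scale /= mulrCA.
Qed.

Lemma shuffle_linr a f g g' s :
  shuffle f (a *: g + g') s = a * shuffle f g s + shuffle f g' s.
Proof.
elim: s f g g' => [|v s IH] f g g'.
  by rewrite /= [(_ + _) _]/(a * g [::] + g' [::]) mulrDr mulrCA.
by rewrite !shuffle_cons mulrDr addrACA -!IH.
Qed.

Lemma shuffleZl a f g s : shuffle (a *: f) g s = a * shuffle f g s.
Proof.
have E h : shuffle (0 : series) g h = 0.
  by have := shuffle_linl (-1) 0 0 g h; rewrite scaler0 addr0 mulN1r addNr.
by rewrite -[a *: f]addr0 shuffle_linl E addr0.
Qed.

Lemma shuffleZr a f g s : shuffle f (a *: g) s = a * shuffle f g s.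
Proof.
have E h : shuffle f (0 : series) h = 0.
  by have := shuffle_linr (-1) f 0 0 h; rewrite scaler0 addr0 mulN1r addNr.
by rewrite -[a *: g]addr0 shuffle_linr E addr0.
Qed.

Lemma dletter_linear v f : form_linear f -> form_linear (dletter v f).
Proof. by move=> fl s1; apply: (fl (v :: s1)). Qed.
Lemma twist_linear n f : form_linear f -> form_linear (twist n f).
Proof.
move=> fl s1 s2 m a u v; rewrite /twist fl !wdeg_cat !wdeg_cons /=.
by rewrite mulrDr /GRing.scale /= mulrCA.
Qed.
Lemma dletter_symmetric v f : form_symmetric f -> form_symmetric (dletter v f).
Proof. by move=> fs s1; apply: (fs (v :: s1)). Qed.
Lemma twist_symmetric n f : form_symmetric f -> form_symmetric (twist n f).
Proof.
move=> fs s1 u v s2; rewrite /twist fs mulrCA; congr (_ * (koszul _ _ _ * _)).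
by rewrite !wdeg_cat !wdeg_cons [tag u + _]addrCA.
Qed.
Lemma dletter_degree v n f :
  form_degree n f -> form_degree (n + tag v) (dletter v f).
Proof. by move=> fd s ns; apply: fd; rewrite wdeg_cons addrA. Qed.
Lemma twist_degree m n f : form_degree n f -> form_degree n (twist m f).
Proof. by move=> fd s ns; rewrite /twist fd ?mulr0. Qed.

Lemma shuffle_linear f g :
  form_linear f -> form_linear g -> form_linear (shuffle f g).
Proof.
move=> fl gl s1; elim: s1 f g fl gl => [|w s1 IH] f g fl gl s2 m a u v.
  rewrite !cat0s !shuffle_cons /=.
  have -> : dletter (vec (a *: u + v)) f =
            a *: dletter (vec u) f + dletter (vec v) f.
    by apply/funext => t; apply: (fl [::]).
  have -> : dletter (vec (a *: u + v)) g =
            a *: dletter (vec u) g + dletter (vec v) g.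
    by apply/funext => t; apply: (gl [::]).
  by rewrite shuffle_linl shuffle_linr addrACA -mulrDr.
rewrite !cat_cons !shuffle_cons.
rewrite (IH _ _ (dletter_linear _ fl) gl).
rewrite (IH _ _ (twist_linear _ fl) (dletter_linear _ gl)).
by rewrite addrACA /GRing.scale /= -mulrDr.
Qed.

Lemma shuffle_symmetric f g :
  form_symmetric f -> form_symmetric g -> form_symmetric (shuffle f g).
Proof.
move=> fs gs s1; elim: s1 f g fs gs => [|w s1 IH] f g fs gs u v s2; last first.
  rewrite !cat_cons !shuffle_cons.
  rewrite (IH _ _ (dletter_symmetric _ fs) gs).
  by rewrite (IH _ _ (twist_symmetric _ fs) (dletter_symmetric _ gs)) -mulrDr.
rewrite !cat0s !shuffle_cons.
have Ed h : form_symmetric h ->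
    dletter v (dletter u h) = koszul K (tag u) (tag v) *: dletter u (dletter v h).
  by move=> hs; apply/funext => t; apply: (hs [::]).
have Et x y : dletter x (twist (tag y) f) =
    koszul K (tag y) (tag x) *: twist (tag y) (dletter x f).
  by apply/funext => t; rewrite /dletter /twist wdeg_cons koszulDr -mulrA.
have Ett : twist (tag v) (twist (tag u) f) = twist (tag u) (twist (tag v) f).
  by apply/funext => t; rewrite /twist mulrCA.
rewrite (Ed f fs) (Ed g gs) !Et !shuffleZl shuffleZr Ett.
rewrite [koszul K (tag v) (tag u)]koszulC.
rewrite !mulrDr !mulrA koszul_sq mul1r.
by rewrite -!addrA; congr (_ + _); rewrite addrCA.
Qed.

Lemma shuffle_degree p q f g :
  form_degree p f -> form_degree q g -> form_degree (p + q) (shuffle f g).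
Proof.
move=> fd gd s; elim: s p q f g fd gd => [|v s IH] p q f g fd gd ns.
  rewrite /=; have [p0|p0] := eqVneq p 0; last first.
    by rewrite fd ?mul0r // wdeg_nil addr0.
  by rewrite gd ?mulr0 //; move: ns; rewrite p0 add0r.
have E : p + q + wdeg (v :: s) = p + (q + tag v) + wdeg s.
  by rewrite wdeg_cons !addrA.
rewrite shuffle_cons (IH (p + tag v) q) //; last first.
- by rewrite [p + tag v + q]addrAC -[p + q + tag v]addrA -E.
- exact: dletter_degree.
rewrite (IH p (q + tag v)) ?addr0 -?E //; first exact: twist_degree.
exact: dletter_degree.
Qed.

Lemma shuffle_fps p q f g :
  is_fps p f -> is_fps q g -> is_fps (p + q) (shuffle f g).
Proof.
case=> fl fs fd [gl gs gd]; split; first exact: shuffle_linear.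
  exact: shuffle_symmetric.
exact: shuffle_degree.
Qed.

Lemma fpsP n (f : fps n) : is_fps n f.
Proof. by case: f => f /= /fps_predP. Qed.

Definition mkfps n (f : series) (fP : is_fps n f) : fps n :=
  Fps (introT (fps_predP n f) fP).

Definition fmul p q (f : fps p) (g : fps q) : fps (p + q) :=
  mkfps (shuffle_fps (fpsP f) (fpsP g)).

Lemma one_fps : is_fps 0 (fun s => (nilp s)%:R).
Proof.
split=> [s1 s2 n a u v|s1 u v s2|s].
- by case: s1 => [|x s1] /=; rewrite scaler0 addr0.
- by case: s1 => [|x s1] /=; rewrite mulr0.
- by case: s => [|x s] //=; rewrite wdeg_nil addr0 eqxx.
Qed.
Definition fone : fps 0 := mkfps one_fps.

(* [V^\vee] as the linear part [S^1(V^\vee)] of the power series. *)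
Definition is_covector n (f : fps n) : Prop := forall s, size s != 1 -> f s = 0.

End FormalPowerSeries.

Notation "f \odot g" := (fmul f g) (at level 40, left associativity).

Definition Oalg (K : fieldType) (V : int -> vectType K) : int -> lmodType K :=
  fun n => fps V n.

(* [O(V) (x) W^\vee] for a finite-dimensional [W]: functions [g] on words in
   [V] and one letter of [W], the pure tensor of [f] and the covector [x] being
   [fun s w => f s * x [:: w]]. *)
Section CovectorValuedSeries.
Variables (K : fieldType) (V W : int -> vectType K).

Local Notation coseries := (seq (letter V) -> letter W -> K^o).

Definition is_cofps (n : int) (g : coseries) : Prop :=
  (forall w, is_fps (n + tag w) (g^~ w)) /\
  (forall s m, linear (fun w : W m => g s (vec w))).
Definition cofps_pred (n : int) : {pred coseries} := fun g => `[< is_cofps n g >].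

Lemma cofps_predP n g : reflect (is_cofps n g) (g \in cofps_pred n).
Proof. exact: asboolP. Qed.

Lemma cofps_submod n : submod_closed (cofps_pred n).
Proof.
split=> [|a f g /cofps_predP[fV fW] /cofps_predP[gV gW]]; apply/cofps_predP.
  split=> [w|s m b u v]; last by rewrite scaler0 addr0.
  by apply/fps_predP; apply: (fps_submod V (n + tag w)).1.
split=> [w|s m b u v].
  apply/fps_predP; apply: (fps_submod V (n + tag w)).2; exact/fps_predP.
have E x : (a *: f + g) s x = a * f s x + g s x by [].
rewrite !E fW gW /GRing.scale /= !mulrDr mulrCA -!addrA; congr (_ + _).
by rewrite addrCA.
Qed.
HB.instance Definition _ n :=
  GRing.isSubmodClosed.Build K coseries (cofps_pred n) (cofps_submod n).

Record cofps (n : int) :=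
  Cofps { cofps_val :> coseries; _ : cofps_val \in cofps_pred n }.
HB.instance Definition _ n := [isSub for @cofps_val n].
HB.instance Definition _ n := [Choice of cofps n by <:].
HB.instance Definition _ n := [SubChoice_isSubLmodule of cofps n by <:].

Definition mkcofps n (g : coseries) (gP : is_cofps n g) : cofps n :=
  Cofps (introT (cofps_predP n g) gP).

Lemma cofpsP n (g : cofps n) : is_cofps n g.
Proof. by case: g => g /= /cofps_predP. Qed.

Lemma pure_cofps p q (f : fps V p) (x : fps W q) :
  is_cofps (p + q) (fun s w => f s * x [:: w]).
Proof.
have [fl fs fd] := fpsP f; have [xl _ xd] := fpsP x.
split=> [w|s m a u v]; last first.
  by rewrite (xl [::] [::]) mulrDr /GRing.scale /= mulrCA.
split=> [s1 s2 m a u v|s1 u v s2|s ns].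
- by rewrite fl mulrDl /GRing.scale /= mulrA.
- by rewrite fs mulrA.
have [p0|p0] := eqVneq (p + wdeg s) 0; last by rewrite fd ?mul0r.
rewrite xd ?mulr0 // wdeg_cons wdeg_nil addr0.
by move: ns; rewrite -[p + q + _]addrA addrAC p0 add0r.
Qed.

(* The pure tensor of [f] and [x]; it is only used for covectors [x]. *)
Definition pure p q (f : fps V p) (x : fps W q) : cofps (p + q) :=
  mkcofps (pure_cofps f x).

Lemma coact_cofps p q (f : fps V p) (g : cofps q) :
  is_cofps (p + q) (fun s w => shuffle f (g^~ w) s).
Proof.
have [gV gW] := cofpsP g; split=> [w|s m a u v].
  by rewrite -addrA; apply: shuffle_fps => //; exact: fpsP.
have -> : g^~ (vec (a *: u + v)) = a *: (g^~ (vec u)) + g^~ (vec v).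
  by apply/funext => t; exact: gW.
exact: shuffle_linr.
Qed.

(* The [O(V)]-module structure of [O(V) (x) W^\vee]. *)
Definition coact p q (f : fps V p) (g : cofps q) : cofps (p + q) :=
  mkcofps (coact_cofps f g).

End CovectorValuedSeries.

Definition OWalg (K : fieldType) (V W : int -> vectType K) : int -> lmodType K :=
  fun n => cofps V W n.

(* The map [I^V : O(V) -> O(V) (x) V^\vee].  The covector factor stands on the
   right, so it is the right derivative, whose Taylor coefficients are obtained
   by appending a letter at the end of the word; [Iuniv_one], [Iuniv_covector]
   and [Iuniv_mul] are the rules that determine it. *)
Section UniversalDerivation.
Variables (K : fieldType) (V : int -> vectType K).

Lemma Iuniv_cofps n (f : fps V n) : is_cofps n (fun s v => f (rcons s v)).
Proof.
have [fl fs fd] := fpsP f; split=> [w|s m a u v]; last first.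
  by rewrite -!cats1 fl.
split=> [s1 s2 m a u v|s1 u v s2|s ns].
- by rewrite !rcons_cat !rcons_cons fl.
- by rewrite !rcons_cat !rcons_cons fs.
- by rewrite fd // wdeg_rcons [wdeg s + _]addrC addrA.
Qed.

Definition Iuniv n (f : fps V n) : cofps V V n := mkcofps (Iuniv_cofps f).

Lemma Iuniv_one : Iuniv (fone V) = 0.
Proof.
by apply/val_inj/funext => s; apply/funext => v /=; case: s.
Qed.

Lemma Iuniv_covector n (x : fps V n) s v :
  is_covector x -> Iuniv x s v = pure (fone V) x s v.
Proof.
move=> xc /=; case: s => [|u s] /=; first by rewrite mul1r.
by rewrite mul0r xc //= size_rcons.
Qed.

Lemma shuffle_rcons (f g : seq (letter V) -> K^o) s v :
  shuffle f g (rcons s v) =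
  shuffle f (fun t => g (rcons t v)) s +
  shuffle (fun t => f (rcons t v)) (fun t => koszul K (tag v) (wdeg t) * g t) s.
Proof.
elim: s f g => [|u s IH] f g.
  by rewrite /= wdeg_nil /koszul !mulr0 !expr0z !mul1r addrC.
have Ef : (fun t => twist (tag u) f (rcons t v)) =
    koszul K (tag u) (tag v) *: twist (tag u) (fun t => f (rcons t v)).
  apply/funext => t.
  by rewrite /twist wdeg_rcons addrC koszulDr -mulrA.
have Eg : dletter u (fun t => koszul K (tag v) (wdeg t) * g t) =
    koszul K (tag u) (tag v) *: twist (tag v) (dletter u g).
  apply/funext => t; rewrite /dletter /twist wdeg_cons koszulDr.
  by rewrite [koszul K (tag v) (tag u)]koszulC -mulrA.
by rewrite rcons_cons !shuffle_cons !IH Ef Eg shuffleZl shuffleZr addrACA.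
Qed.

Lemma koszul_wdeg m n (h : seq (letter V) -> K^o) t :
  form_degree n h -> koszul K m (wdeg t) * h t = koszul K m n * h t.
Proof.
move=> hd; have [n0|n0] := eqVneq (n + wdeg t) 0; last by rewrite hd ?mulr0.
by move/eqP: n0; rewrite addr_eq0 => /eqP ->; rewrite koszulNr.
Qed.

Lemma shuffleC p q (f g : seq (letter V) -> K^o) s :
  form_degree p f -> form_degree q g ->
  shuffle f g s = koszul K p q * shuffle g f s.
Proof.
have twE n (h : seq (letter V) -> K^o) (v : letter V) : form_degree n h -> twist (tag v) h = koszul K (tag v) n *: h.
  move=> hd; apply/funext => t; rewrite /twist.
  exact: koszul_wdeg.
elim: s p q f g => [|v s IH] p q f g fd gd.
  rewrite /= [g [::] * _]mulrC.
  have [p0|p0] := eqVneq p 0; first by rewrite p0 /koszul mul0r expr0z mul1r.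
  by rewrite fd ?mul0r ?mulr0 // wdeg_nil addr0.
rewrite !shuffle_cons (twE p f v fd) (twE q g v gd) !shuffleZl.
rewrite (IH (p + tag v) q) //; last exact: dletter_degree.
rewrite (IH p (q + tag v) f) //; last exact: dletter_degree.
rewrite koszulDl koszulDr mulrDr [LHS]addrC !mulrA; congr (_ * _ + _ * _).
by rewrite mulrAC [koszul K p (tag v)]koszulC koszul_sq mul1r.
Qed.

Lemma Iuniv_mul p q (f : fps V p) (g : fps V q) s v :
  Iuniv (f \odot g) s v =
  coact f (Iuniv g) s v + koszul K p q * coact g (Iuniv f) s v.
Proof.
have [_ _ fd] := fpsP f; have [_ _ gd] := fpsP g.
rewrite /= shuffle_rcons; congr (_ + _).
have fv : form_degree (p + tag v) (fun t => f (rcons t v)).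
  by move=> t nt; apply: fd; rewrite wdeg_rcons [wdeg t + _]addrC addrA.
have -> : (fun t => koszul K (tag v) (wdeg t) * g t) =
    koszul K (tag v) q *: (g : _ -> K^o).
  by apply/funext => t; exact: koszul_wdeg.
rewrite shuffleZr (shuffleC _ fv gd) koszulDl mulrA; congr (_ * _).
by rewrite mulrCA koszul_sq mulr1.
Qed.

End UniversalDerivation.

Section Pullback.
Variables (K : fieldType) (V W U : int -> vectType K).
Variable h : forall n, {linear V n -> W n}.

Definition push (v : letter V) : letter W := vec (h (tag v) (tagged v)).

Lemma wdeg_push s : wdeg (map push s) = wdeg s.
Proof. by rewrite /wdeg big_map. Qed.

Lemma pull_is_fps n (f : seq (letter W) -> K^o) :
  is_fps n f -> is_fps n (fun s => f (map push s)).
Proof.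
case=> fl fs fd; split=> [s1 s2 m a u v|s1 u v s2|s ns].
- by rewrite !map_cat /= /push /= linearP fl.
- by rewrite !map_cat /= fs.
- by rewrite fd // wdeg_push.
Qed.

Definition pull n (f : fps W n) : fps V n := mkfps (pull_is_fps (fpsP f)).

Lemma pullco_cofps n (g : cofps W U n) :
  is_cofps n (fun (s : seq (letter V)) (u : letter U) => g (map push s) u).
Proof.
have [gV gW] := cofpsP g; split=> [u|s m]; last exact: gW.
exact: (pull_is_fps (gV u)).
Qed.

(* The pullback tensored with the identity of [U^\vee]. *)
Definition pullco n (g : cofps W U n) : cofps V U n := mkcofps (pullco_cofps g).

End Pullback.

(* [gend E k] is [\prod_n Hom(E_n, E_(n + k))].  The target degree is any [m]
   provably equal to [n + k], so that composites need no transport. *)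
Section GradedEndomorphisms.
Variables (K : fieldType) (E : int -> lmodType K).

Record gend (k : int) := Gend {
  gend_fun :> forall n m, m = n + k -> E n -> E m;
  gend_linear : forall n m e, linear (@gend_fun n m e) }.
Arguments gend_fun {k} _ n m _ _.

Lemma gend_eq k (f g : gend k) : (forall n m e x, f n m e x = g n m e x) -> f = g.
Proof.
case: f g => f fl [g gl] /= fg.
have E1 : f = g by do 4![apply/functional_extensionality_dep => ?]; exact: fg.
by subst g; congr Gend; exact: Prop_irrelevance.
Qed.

Lemma zero_linear k n m (e : m = n + k) : linear (fun _ : E n => 0 : E m).
Proof. by move=> a u v; rewrite scaler0 addr0. Qed.
Lemma opp_linear k (f : gend k) n m (e : m = n + k) :
  linear (fun x : E n => - f n m e x).
Proof. by move=> a u v; rewrite gend_linear opprD scalerN. Qed.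
Lemma add_linear k (f g : gend k) n m (e : m = n + k) :
  linear (fun x : E n => f n m e x + g n m e x).
Proof. by move=> a u v; rewrite !gend_linear scalerDr addrACA. Qed.
Lemma scale_linear k (c : K) (f : gend k) n m (e : m = n + k) :
  linear (fun x : E n => c *: f n m e x).
Proof. by move=> a u v; rewrite gend_linear scalerDr !scalerA mulrC. Qed.

Definition gend0 k : gend k := Gend (@zero_linear k).
Definition gend_opp k (f : gend k) : gend k := Gend (opp_linear f).
Definition gend_add k (f g : gend k) : gend k := Gend (add_linear f g).
Definition gend_scale k (c : K) (f : gend k) : gend k := Gend (scale_linear c f).

Lemma gend_addA k : associative (@gend_add k).
Proof. by move=> f g h; apply: gend_eq => *; rewrite /= addrA. Qed.
Lemma gend_addC k : commutative (@gend_add k).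
Proof. by move=> f g; apply: gend_eq => *; rewrite /= addrC. Qed.
Lemma gend_add0 k : left_id (gend0 k) (@gend_add k).
Proof. by move=> f; apply: gend_eq => *; rewrite /= add0r. Qed.
Lemma gend_addN k : left_inverse (gend0 k) (@gend_opp k) (@gend_add k).
Proof. by move=> f; apply: gend_eq => *; rewrite /= addNr. Qed.

HB.instance Definition _ k := gen_eqMixin (gend k).
HB.instance Definition _ k := gen_choiceMixin (gend k).
HB.instance Definition _ k := GRing.isZmodule.Build (gend k)
  (@gend_addA k) (@gend_addC k) (@gend_add0 k) (@gend_addN k).

Lemma gend_scaleA k a b (f : gend k) :
  gend_scale a (gend_scale b f) = gend_scale (a * b) f.
Proof. by apply: gend_eq => *; rewrite /= scalerA. Qed.
Lemma gend_scale1 k : left_id 1 (@gend_scale k).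
Proof. by move=> f; apply: gend_eq => *; rewrite /= scale1r. Qed.
Lemma gend_scaleDr k : right_distributive (@gend_scale k) (@gend_add k).
Proof. by move=> a f g; apply: gend_eq => *; rewrite /= scalerDr. Qed.
Lemma gend_scaleDl k (f : gend k) : {morph (@gend_scale k)^~ f : a b / a + b >-> gend_add a b}.
Proof. by move=> a b; apply: gend_eq => *; rewrite /= scalerDl. Qed.

HB.instance Definition _ k := GRing.Zmodule_isLmodule.Build K (gend k)
  (@gend_scaleA k) (@gend_scale1 k) (@gend_scaleDr k) (@gend_scaleDl k).

Lemma gcomp_degree (n m k l : int) : m = n + (k + l) -> m = n + l + k.
Proof. by rewrite -addrA [l + k]addrC. Qed.

Lemma gcomp_linear k l (f : gend k) (g : gend l) n m (e : m = n + (k + l)) :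
  linear (fun x : E n => f (n + l) m (gcomp_degree e) (g n (n + l) erefl x)).
Proof. by move=> a u v; rewrite !gend_linear. Qed.

Definition gcomp k l (f : gend k) (g : gend l) : gend (k + l) :=
  Gend (gcomp_linear f g).

Definition gapp k n (f : gend k) (x : E n) : E (n + k) := f n (n + k) erefl x.

End GradedEndomorphisms.

Definition EndAlg (K : fieldType) (E : int -> lmodType K) : int -> lmodType K :=
  fun k => gend E k.

(* Elements of [U (x) W] are finite formal sums of pure tensors of homogeneous
   elements; [teq], the equality of [U (x) W], identifies two formal sums when
   no (family of) bilinear maps distinguishes them. *)
Section Tensors.
Variables (K : fieldType) (U W : int -> lmodType K).

Definition tens : Type := seq (homog (fun n => U n) * homog (fun n => W n)).

Definition bilinear_family (X : lmodType K) (b : forall p q, U p -> W q -> X) :=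
  (forall p q w, linear (b p q ^~ w)) /\ (forall p q u, linear (b p q u)).

Definition tsum (X : lmodType K) (b : forall p q, U p -> W q -> X) (x : tens) : X :=
  \sum_(t <- x) b (tag t.1) (tag t.2) (tagged t.1) (tagged t.2).

Definition teq (x y : tens) : Prop :=
  forall (X : lmodType K) (b : forall p q, U p -> W q -> X),
    bilinear_family b -> tsum b x = tsum b y.

Definition tdegree (n : int) (x : tens) : Prop :=
  all (fun t => tag t.1 + tag t.2 == n) x.

Definition tpure p q (u : U p) (w : W q) : homog (fun n => U n) * homog (fun n => W n) :=
  (hel (T := fun n => U n) u, hel (T := fun n => W n) w).

End Tensors.
Arguments tpure {K} U W {p q} u w.

Notation "x =t y" := (teq x y) (at level 70, no associativity).

Section TensorMap.
Variables (K : fieldType) (U U' W : int -> lmodType K) (d : int -> int).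

(* [T (x) id_W] *)
Definition tmap (T : forall p, U p -> U' (d p)) (x : tens U W) : tens U' W :=
  [seq tpure U' W (T _ (tagged t.1)) (tagged t.2) | t <- x].

End TensorMap.

Section TensorProduct.
Variables (K : fieldType) (V : int -> vectType K) (E : int -> lmodType K).

Definition tmul (x y : tens (Oalg V) (EndAlg E)) : tens (Oalg V) (EndAlg E) :=
  [seq tpure (Oalg V) (EndAlg E)
         (koszul K (tag s.2) (tag t.1) *: (tagged s.1 \odot tagged t.1))
         (gcomp (tagged s.2) (tagged t.2)) | s <- x, t <- y].

End TensorProduct.

Section LPairs.
Variable K : fieldType.

Definition fin_dim (V : int -> vectType K) : Prop :=
  exists N : nat, forall n : int, (N < `|n|)%N -> \dim {:V n} = 0%N.

Definition op1 (V : int -> vectType K) : Type :=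
  forall n, {linear fps V n -> fps V (n + 1)}.

(* The Leibniz rule compares the underlying functions because [p + q + 1],
   [p + 1 + q] and [p + (q + 1)] are distinct as indices. *)
Definition derivation (V : int -> vectType K) (Q : op1 V) : Prop :=
  forall p q (f : fps V p) (g : fps V q) s,
    Q _ (f \odot g) s =
    (Q _ f \odot g) s + koszul K 1 p * (f \odot Q _ g) s.

Definition homological (V : int -> vectType K) (Q : op1 V) : Prop :=
  derivation Q /\ forall n (f : fps V n), Q _ (Q _ f) = 0.

Section Subspace.
Variables (L : int -> vectType K) (A : forall n, {vspace L n}).

Definition subfam : int -> vectType K := fun n => subvs_of (A n).
Definition incl n : {linear subfam n -> L n} := @vsval K (L n) (A n).

Definition jdual n (f : fps L n) : fps subfam n := pull incl f.
Definition Jmap n (f : fps L n) : cofps subfam L n := pullco incl (Iuniv f).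

(* [A^\perp], the kernel of [L^\vee -> A^\vee]. *)
Record perp (n : int) := Perp {
  perp_val :> fps L n;
  perp_covector : is_covector perp_val;
  perp_jdual : jdual perp_val = 0 }.

(* [w] is, up to the sign convention, the bracket [lambda_k(v_1, .., v_k)] of
   the letters of [s]: brackets are the Taylor coefficients of [Q]. *)
Definition is_bracket (Q : op1 L) (s : seq (letter L)) (w : L (wdeg s + 1)) : Prop :=
  forall n (x : fps L n), is_covector x -> Q n x s = x [:: vec w].

Definition bracket_closed (Q : op1 L) : Prop :=
  forall (s : seq (letter subfam)) w,
    is_bracket Q (s := map (push incl) s) w -> w \in A (wdeg (map (push incl) s) + 1).

(* [A] is a subalgebra and [QA] is its induced homological vector field. *)
Definition SHLie_pair (QL : op1 L) (QA : op1 subfam) : Prop :=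
  [/\ homological QL, bracket_closed QL, homological QA &
      forall n (f : fps L n), jdual (QL _ f) = QA _ (jdual f)].

(* [p] presents [B] as [L / A]. *)
Definition quotient_map (B : int -> vectType K)
    (p : forall n, {linear L n -> B n}) : Prop :=
  (forall n (b : B n), exists v, p n v = b) /\
  (forall n (v : L n), (p n v == 0) = (v \in A n)).

End Subspace.
End LPairs.

Section Modules.
Variables (K : fieldType) (V : int -> vectType K) (E : int -> lmodType K).

(* [Q_V + D] on [O(V) (x) E]. *)
Definition module_diff (Q : op1 V) (D : tens (Oalg V) (EndAlg E))
    (x : tens (Oalg V) E) : tens (Oalg V) E :=
  flatten [seq
    tpure (Oalg V) E (Q _ (tagged t.1)) (tagged t.2) ::
    [seq tpure (Oalg V) E
           (koszul K 1 (tag t.1) *: (tagged t.1 \odot tagged d.1))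
           (gapp (tagged d.2) (tagged t.2))
       | d <- D]
    | t <- x].

Definition is_module (Q : op1 V) (D : tens (Oalg V) (EndAlg E)) : Prop :=
  tdegree 1 D /\
  forall x : tens (Oalg V) E, module_diff Q D (module_diff Q D x) =t [::].

End Modules.

(* The cochain complex [O(A) (x) B^\vee (x) End(E)], with [B^\vee = A^\perp]. *)
Section Cochains.
Variables (K : fieldType) (L : int -> vectType K) (A : forall n, {vspace L n}).
Variable E : int -> lmodType K.
Local Notation OA := (Oalg (subfam A)).
Local Notation OAL := (OWalg (subfam A) L).
Local Notation EE := (EndAlg E).

Definition cochain : Type :=
  seq (homog (fun n => OA n) * homog (fun n => perp A n) * homog (fun n => EE n)).

Definition cdegree (n : int) (c : cochain) : Prop :=
  all (fun t => tag t.1.1 + tag t.1.2 + tag t.2 == n) c.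

(* A cochain as an element of [(O(A) (x) L^\vee) (x) End(E)]. *)
Definition cembed (c : cochain) : tens OAL EE :=
  [seq tpure OAL EE (pure (tagged t.1.1) (perp_val (tagged t.1.2))) (tagged t.2) | t <- c].

(* The graded commutator with [D]; moving [eta] in [D = eta (x) psi] to the left
   of [g (x) phi] gives the signs of the second term. *)
Definition tcomm (D : tens OA EE) (x : tens OAL EE) : tens OAL EE :=
  flatten [seq [::
      tpure OAL EE
        (koszul K (tag d.2) (tag t.1) *: coact (tagged d.1) (tagged t.1))
        (gcomp (tagged d.2) (tagged t.2));
      tpure OAL EE
        (- (koszul K (tag d.1 + tag d.2) (tag t.1 + tag t.2) *
            koszul K (tag t.1 + tag t.2) (tag d.1))
           *: coact (tagged d.1) (tagged t.1))
        (gcomp (tagged t.2) (tagged d.2))]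
    | d <- D, t <- x].

(* [Q_A + D^\perp + [D, -]]. *)
Definition cdiff (QL : op1 L) (QA : op1 (subfam A)) (D : tens OA EE)
    (c : cochain) : tens OAL EE :=
  [seq tpure OAL EE (pure (QA _ (tagged t.1.1)) (perp_val (tagged t.1.2))) (tagged t.2)
     | t <- c] ++
  [seq tpure OAL EE
         (koszul K 1 (tag t.1.1) *:
            coact (tagged t.1.1) (Jmap A (QL _ (perp_val (tagged t.1.2)))))
         (tagged t.2)
     | t <- c] ++
  tcomm D (cembed c).

End Cochains.

(* Elements [x + hbar y] over [K[hbar]], [hbar^2 = 0], are pairs [(x, y)]. *)
Section Deformations.
Variables (K : fieldType) (L : int -> vectType K) (A : forall n, {vspace L n}).
Local Notation OL n := (fps L n : Type).

Definition hmap (U W : Type) (f : U -> W) (x : U * U) : W * W := (f x.1, f x.2).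

(* The [K[hbar]]-linear extension of [f + hbar g]. *)
Definition hext (U : Type) (W : lmodType K) (f g : U -> W) (x : U * U) : W * W :=
  (f x.1, f x.2 + g x.1).

Definition hmul p q (x : OL p * OL p) (y : OL q * OL q) :
    fps L (p + q) * fps L (p + q) :=
  (x.1 \odot y.1, x.1 \odot y.2 + x.2 \odot y.1).

Definition inf_deformation (QL Qp : op1 L) : Prop :=
  derivation Qp /\
  forall n (x : OL n * OL n), hext (QL _) (Qp _) (hext (QL n) (Qp n) x) = (0, 0).

(* Neither [Q_A] nor [D^\perp(x) = J(Q_L(x))] is deformed. *)
Definition A_compatible (QL : op1 L) (QA : op1 (subfam A)) (Qp : op1 L) : Prop :=
  (forall n (x : OL n * OL n),
     hmap (@jdual K L A _) (hext (QL n) (Qp n) x) =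
     hmap (QA n) (hmap (@jdual K L A _) x)) /\
  (forall n (x : perp A n),
     hmap (@Jmap K L A _) (hext (QL n) (Qp n) (x : fps L n, 0)) =
     (Jmap A (QL n x), 0)).

(* [1 + hbar lam] is a gauge equivalence; [O(B)] is embedded in [O(L)] by
   [pull p]. *)
Definition gauge (B : int -> vectType K) (p : forall n, {linear L n -> B n})
    (lam : forall n, {linear fps L n -> fps L n}) : Prop :=
  let sigma n := hext (fun f : fps L n => f) (lam n) in
  [/\ forall n, bijective (sigma n),
      sigma 0 (fone L, 0) = (fone L, 0) /\
      (forall m n (x : OL m * OL m) (y : OL n * OL n),
         sigma (m + n) (hmul x y) = hmul (sigma m x) (sigma n y)),
      (forall n (b : fps B n * fps B n),
         sigma n (hmap (@pull K L B p n) b) = hmap (@pull K L B p n) b) &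
      (forall n (x : OL n * OL n),
         hmap (@jdual K L A n) (sigma n x) = hmap (@jdual K L A n) x)].

Definition gauge_equivalent (B : int -> vectType K)
    (p : forall n, {linear L n -> B n}) (QL Qp Qp' : op1 L) : Prop :=
  exists2 lam : forall n, {linear fps L n -> fps L n}, gauge p lam &
    forall n (x : OL n * OL n),
      hext (fun f => f) (lam _) (hext (QL n) (Qp n) x) =
      hext (QL n) (Qp' n) (hext (fun f => f) (lam n) x).

End Deformations.

Section AtiyahClass.
Variables (K : fieldType) (L : int -> vectType K) (A : forall n, {vspace L n}).
Variable E : int -> lmodType K.
Local Notation OA := (Oalg (subfam A)).
Local Notation OL := (Oalg L).
Local Notation OAL := (OWalg (subfam A) L).
Local Notation EE := (EndAlg E).
Local Notation htens U W := (tens U W * tens U W)%type.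

Definition lift_of (DAE : tens OA EE) (D : htens OL EE) : Prop :=
  [/\ tdegree 1 D.1, tdegree 1 D.2,
      tmap (U := OL) (U' := OA) (W := EE) (@jdual K L A) D.1 =t DAE &
      tmap (U := OL) (U' := OA) (W := EE) (@jdual K L A) D.2 =t [::]].

(* [Q(hbar)(D) + D^2] *)
Definition curvature (QL Qp : op1 L) (D : htens OL EE) : htens OL EE :=
  (tmap (U := OL) (U' := OL) (W := EE) QL D.1 ++ tmul D.1 D.1,
   tmap (U := OL) (U' := OL) (W := EE) QL D.2 ++
   tmap (U := OL) (U' := OL) (W := EE) Qp D.1 ++
   tmul D.1 D.2 ++ tmul D.2 D.1).

Definition atiyah (QL Qp : op1 L) (D : htens OL EE) : htens OAL EE :=
  hmap (tmap (U := OL) (U' := OAL) (W := EE) (@Jmap K L A)) (curvature QL Qp D).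

Definition cocycle2 QL QA DAE (a : htens OAL EE) : Prop :=
  exists c : cochain A E * cochain A E,
    [/\ cdegree 2 c.1 /\ cdegree 2 c.2,
        a.1 =t cembed c.1 /\ a.2 =t cembed c.2 &
        cdiff QL QA DAE c.1 =t [::] /\ cdiff QL QA DAE c.2 =t [::]].

(* [a] and [a'] are cocycles defining the same class in
   [H^2_CE(A, B^\vee (x) End(E))[hbar]]. *)
Definition same_class2 QL QA DAE (a a' : htens OAL EE) : Prop :=
  [/\ cocycle2 QL QA DAE a, cocycle2 QL QA DAE a' &
      exists b : cochain A E * cochain A E,
        [/\ cdegree 1 b.1 /\ cdegree 1 b.2,
            a.1 =t a'.1 ++ cdiff QL QA DAE b.1 &
            a.2 =t a'.2 ++ cdiff QL QA DAE b.2]].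

End AtiyahClass.

(* Main.v *)
Require Import Defs.
From HB Require Import structures.
From mathcomp Require Import all_boot all_order all_algebra.
From mathcomp Require Import boolp functions.
From mathcomp Require Import zify ring.

Set Implicit Arguments.
Unset Strict Implicit.
Unset Printing Implicit Defensive.

Import GRing.Theory.
Local Open Scope ring_scope.

(** Write [j] for the restriction [O(L) -> O(A)] and [J] for the restricted
    universal derivation, both extended to [End(E)]-valued series, and let [I]
    be the kernel of [j].  Everything rests on the following facts.

    - [J] is a derivation along [j]: [J (x y) = j x . J y + J x . j y] up to
      Koszul signs ([JmapM], [tsum_JJ_mul]).  So [J] vanishes on products of
      two elements of [I] ([JJ_mul_kernel]).
    - In characteristic zero and finite dimension, [A^\perp] generates the
      ideal [I] ([perp_generates]).  Therefore [J] maps [I (x) End(E)] to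
      [B^\vee]-valued cochains, and it is a chain map: if [D] lifts [D^{A,E}]
      and [x] lies in [I (x) End(E)], then the differential of the cochain
      [J x] is [J (Q_L x + [D, x])] ([cochain_of_kernel]).
    - A derivation [T] with [j T = 0] that satisfies [J T xi = 0] for [xi] in
      [A^\perp] satisfies [J T = 0] on all of [I] ([Jmap_kernel]).
      Compatibility says that [Q_+] is such a derivation, and the gauge
      conditions say that [lam] is one: [lam] kills [O(B)], which contains
      [A^\perp] ([perp_pull]).

    The curvature [R = Q(hbar) D + D^2] lies in [I (x) End(E)] because
    [D^{A,E}] is flat ([module_flat]), and the Bianchi identity then makes
    [J R] a cocycle ([bianchi], [atiyah_cocycle]).

    To compare the classes, write [D = D_1 + hbar D_2] and let [delta] be
    [x |-> J (Q_L x) + D^{A,E} . J x + J x . D^{A,E}], which on elements of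
    degree 1 of [I (x) End(E)] is the differential of [J x].  By the derivation
    rule the two components of [J R] are [delta D_1] and
    [delta D_2 + J (Q_+ D_1)] ([atiyah_sum]).  The gauge relation
    [Q_+ + lam Q_L = Q_L lam + Q_+'] and [J (lam R) = 0] give
    [J (Q_+ D_1) = J (Q_+' D_1) + delta (lam D_1)] ([gauge_sum]), and [D_1] may
    be replaced by [D_1'] in [J (Q_+' D_1)] as [D_1 - D_1'] lies in
    [I (x) End(E)].  Hence the cocycles differ by the differentials of
    [J (D_1 - D_1')] and [J (D_2 - D_2' + lam D_1)].

    An equality of tensors is proved by evaluating both sides with [tsum] on an
    arbitrary bilinear family, called a test below.  All identities become
    identities between elements of a vector space, and degrees that are equal
    without being convertible cause no transport. *)

(** * Graded families and tensors *)

(** The degrees [p + q + 1] and [p + (q + 1)] are different indices, so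
    identities in [U] can only be stated through evaluations [ev].  The lemmas
    of this section carry such identities to the values of any family of maps
    that is defined in all degrees. *)
Section LinearFamilies.
Variables (K : fieldType) (S : Type) (U : int -> lmodType K).
Variable ev : forall p, U p -> S -> K.
Hypothesis ev_linear : forall p a (u v : U p) s, ev (a *: u + v) s = a * ev u s + ev v s.
Hypothesis ev_inj : forall p (u v : U p), (forall s, ev u s = ev v s) -> u = v.

Lemma ev0 p s : ev (0 : U p) s = 0.
Proof.
by have := ev_linear (-1) (0 : U p) 0 s; rewrite scaler0 addr0 mulN1r addNr.
Qed.

Lemma evB p (u v : U p) s : ev (u - v) s = ev u s - ev v s.
Proof. by rewrite addrC -scaleN1r ev_linear mulN1r addrC. Qed.

Lemma lin_sum (X : lmodType K) (l : forall p, U p -> X)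
    (l_linear : forall p, linear (l p)) I (r : seq I) (p_ : I -> int)
    (u_ : forall i, U (p_ i)) p (u : U p) :
  all (fun i => p_ i == p) r ->
  (forall s, ev u s = \sum_(i <- r) ev (u_ i) s) ->
  l p u = \sum_(i <- r) l (p_ i) (u_ i).
Proof.
have l0 m : l m 0 = 0.
  by have := l_linear m (-1) 0 0; rewrite scaler0 addr0 scaleN1r addNr.
elim: r u => [|i r IH] u /=.
  move=> _ E; rewrite big_nil; suff -> : u = 0 by rewrite l0.
  by apply: ev_inj => s; rewrite E big_nil ev0.
case/andP=> /eqP ip rp E; rewrite big_cons.
have [v vE lv] : exists2 v : U p, forall s, ev v s = ev (u_ i) s & l _ v = l _ (u_ i).
  by case: _ / ip; exists (u_ i).
rewrite -(IH (u - v)) // => [|s]; last first.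
  by rewrite evB E big_cons vE addrC addKr.
by rewrite -lv -[u in LHS](subrK v) -[v in _ + v]scale1r addrC l_linear scale1r.
Qed.

Lemma lin_comb (X : lmodType K) (l : forall p, U p -> X)
    (l_linear : forall p, linear (l p)) p p1 p2 (u : U p) (u1 : U p1) (u2 : U p2) c :
  p1 = p -> p2 = p -> (forall s, ev u s = ev u1 s + c * ev u2 s) ->
  l p u = l p1 u1 + c *: l p2 u2.
Proof.
move=> e1 e2; subst p1 p2 => E.
by rewrite addrC -l_linear; congr l; apply: ev_inj => s; rewrite ev_linear addrC E.
Qed.

Lemma lin_same (X : Type) (l : forall p, U p -> X) p p1 (u : U p) (u1 : U p1) :
  p1 = p -> (forall s, ev u s = ev u1 s) -> l p u = l p1 u1.
Proof. by move=> e1; subst p1 => E; congr l; apply: ev_inj. Qed.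

End LinearFamilies.

Section Components.
Variables (K : fieldType) (F : int -> lmodType K).

(** The projection of a homogeneous element to degree [n], zero in the other
    degrees. *)
Definition component n (v : homog (fun m => F m)) : F n :=
  match tag v =P n with
  | ReflectT e => eq_rect (tag v) (fun m => F m) (tagged v) n e
  | ReflectF _ => 0
  end.

Lemma component_eq n (v : F n) : component n (hel (T := fun m => F m) v) = v.
Proof.
rewrite /component; case: eqP => [e|//] /=.
by rewrite (eq_irrelevance e erefl).
Qed.

Lemma component_neq n v : tag v != n -> component n v = 0.
Proof. by rewrite /component; case: eqP. Qed.

Lemma component_linear n m :
  linear (fun v : F m => component n (hel (T := fun m => F m) v)).
Proof.
move=> c u v; have [mn|mn] := eqVneq m n.
  by subst m; rewrite !component_eq.
by rewrite !component_neq // scaler0 addr0.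
Qed.
End Components.

Section TensorSums.
Variables (K : fieldType) (U W : int -> lmodType K).
Implicit Types x y z : tens U W.

Lemma tsum_cat (X : lmodType K) (b : forall p q, U p -> W q -> X) x y :
  tsum b (x ++ y) = tsum b x + tsum b y.
Proof. exact: big_cat. Qed.

Lemma tsum_nil (X : lmodType K) (b : forall p q, U p -> W q -> X) : tsum b [::] = 0.
Proof. exact: big_nil. Qed.

Lemma teq_sym x y : x =t y -> y =t x.
Proof. by move=> xy X b hb; rewrite xy. Qed.
Lemma teq_trans x y z : x =t y -> y =t z -> x =t z.
Proof. by move=> xy yz X b hb; rewrite xy ?yz. Qed.

Section Bilinear.
Variables (X : lmodType K) (b : forall p q, U p -> W q -> X).
Hypothesis hb : bilinear_family b.

Lemma bilPl p q a u v (w : W q) : b (a *: u + v : U p) w = a *: b u w + b v w.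
Proof. by case: hb => l _; exact: l. Qed.
Lemma bilPr p q a (u : U p) (v w : W q) : b u (a *: v + w) = a *: b u v + b u w.
Proof. by case: hb => _ l; exact: l. Qed.
Lemma bil0l p q (w : W q) : b (0 : U p) w = 0.
Proof. by have := bilPl (-1) (0 : U p) 0 w; rewrite scaler0 addr0 scaleN1r addNr. Qed.
Lemma bil0r p q (u : U p) : b u (0 : W q) = 0.
Proof. by have := bilPr (-1) u (0 : W q) 0; rewrite scaler0 addr0 scaleN1r addNr. Qed.
Lemma bilZl p q a u (w : W q) : b (a *: u : U p) w = a *: b u w.
Proof. by rewrite -[a *: u]addr0 bilPl bil0l addr0. Qed.
Lemma bilDl p q u v (w : W q) : b (u + v : U p) w = b u w + b v w.
Proof. by rewrite -[u]scale1r bilPl !scale1r. Qed.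
End Bilinear.

Definition tscale (c : K) (x : tens U W) : tens U W :=
  [seq tpure U W (c *: (tagged t.1 : U (tag t.1))) (tagged t.2) | t <- x].

Lemma tsum_scale (X : lmodType K) (b : forall p q, U p -> W q -> X) c x :
  bilinear_family b -> tsum b (tscale c x) = c *: tsum b x.
Proof.
move=> hb; rewrite /tsum big_map scaler_sumr.
by apply: eq_bigr => t _; exact: bilZl.
Qed.

End TensorSums.

Section TensorMaps.
Variables (K : fieldType) (U U' W : int -> lmodType K) (d : int -> int).
Variable T : forall p, U p -> U' (d p).
Hypothesis T_linear : forall p, linear (T (p := p)).

Lemma bilinear_map (X : lmodType K) (b : forall p q, U' p -> W q -> X) :
  bilinear_family b -> bilinear_family (fun p q (u : U p) (w : W q) => b _ _ (T u) w).
Proof.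
move=> hb; split=> p q u; last exact: hb.2.
by move=> a v w; rewrite T_linear (bilPl hb).
Qed.

Lemma tsum_map (X : lmodType K) (b : forall p q, U' p -> W q -> X) x :
  tsum b (tmap T x) = tsum (fun p q (u : U p) (w : W q) => b _ _ (T u) w) x.
Proof. by rewrite /tsum big_map. Qed.

Lemma teq_map (x y : tens U W) : x =t y -> tmap T x =t tmap T y.
Proof. by move=> xy X b hb; rewrite !tsum_map; apply: xy; exact: bilinear_map. Qed.

Lemma tmap_scale c x : tmap T (tscale c x) =t tscale c (tmap (W := W) T x).
Proof.
move=> X b hb; rewrite tsum_scale // !tsum_map.
exact: (tsum_scale _ _ (bilinear_map hb)).
Qed.

Lemma tmap_cat x y : tmap (W := W) T (x ++ y) = tmap T x ++ tmap T y.
Proof. exact: map_cat. Qed.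
End TensorMaps.

(** * The algebra of power series *)

Section PowerSeriesAlgebra.
Variables (K : fieldType) (V : int -> vectType K).
Local Notation series := (seq (letter V) -> K^o).
Implicit Types f g h : series.

Lemma fps_eq n (f g : fps V n) : (forall s, f s = g s) -> f = g.
Proof. by move=> fg; apply/val_inj/funext. Qed.

Lemma fps_same (X : Type) (l : forall p, fps V p -> X) p p1 (f : fps V p) (f1 : fps V p1) :
  p1 = p -> (forall s, f s = f1 s) -> l p f = l p1 f1.
Proof. exact: (@lin_same K _ (Oalg V) (fun p (u : fps V p) s => u s) fps_eq). Qed.

Lemma fps_comb (X : lmodType K) (l : forall p, fps V p -> X)
    (l_linear : forall p, linear (l p)) p p1 p2 (f : fps V p) (f1 : fps V p1)
    (f2 : fps V p2) c :
  p1 = p -> p2 = p -> (forall s, f s = f1 s + c * f2 s) ->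
  l p f = l p1 f1 + c *: l p2 f2.
Proof.
by move=> *; apply: (@lin_comb K _ (Oalg V) (fun p (u : fps V p) s => u s)) => //;
  exact: fps_eq.
Qed.

Lemma fps_sum (X : lmodType K) (l : forall p, fps V p -> X)
    (l_linear : forall p, linear (l p)) I (r : seq I) (p_ : I -> int)
    (f_ : forall i, fps V (p_ i)) p (f : fps V p) :
  all (fun i => p_ i == p) r ->
  (forall s, f s = \sum_(i <- r) f_ i s) ->
  l p f = \sum_(i <- r) l (p_ i) (f_ i).
Proof.
move=> *; apply: (@lin_sum K _ (Oalg V) (fun p (u : fps V p) s => u s)) => //.
exact: fps_eq.
Qed.

Lemma fps_lin n a (f g : fps V n) s : (a *: f + g) s = a * f s + g s.
Proof. by []. Qed.

Lemma dletter_shuffle v f g :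
  dletter v (shuffle f g) =
  1 *: (shuffle (dletter v f) g : series) + (shuffle (twist (tag v) f) (dletter v g) : series).
Proof. by rewrite scale1r; apply/funext. Qed.

(** Twisting by a degree is an algebra morphism: the sign is multiplicative in
    the word. *)
Lemma twist_shuffle n f g :
  twist n (shuffle f g) = shuffle (twist n f) (twist n g).
Proof.
apply/funext => s; elim: s f g => [|v s IH] f g.
  by rewrite /twist /= wdeg_nil /koszul mulr0 expr0z !mul1r.
have dt h : dletter v (twist n h) = koszul K n (tag v) *: twist n (dletter v h).
  by apply/funext => t; rewrite /dletter /twist wdeg_cons koszulDr -mulrA.
have tt : twist (tag v) (twist n f) = twist n (twist (tag v) f).
  by apply/funext => t; rewrite /twist mulrCA.
rewrite shuffle_cons !dt shuffleZl shuffleZr tt -!IH -mulrDr.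
rewrite /twist wdeg_cons koszulDr shuffle_cons -mulrA; congr (_ * _).
by rewrite mulrDr.
Qed.

(** By induction on the word: [dletter v] is a twisted derivation of the shuffle
    product, and both bracketings expand to the same three terms. *)
Lemma shuffleA f g h s : shuffle (shuffle f g) h s = shuffle f (shuffle g h) s.
Proof.
elim: s f g h => [|v s IH] f g h; first by rewrite /= mulrA.
rewrite !shuffle_cons !dletter_shuffle shuffle_linl shuffle_linr !mul1r.
by rewrite twist_shuffle !IH addrA.
Qed.

Lemma shuffle0l g s : shuffle (0 : series) g s = 0.
Proof. by rewrite -[0](scale0r (0 : series)) shuffleZl mul0r. Qed.
Lemma shuffle0r f s : shuffle f (0 : series) s = 0.
Proof. by rewrite -[0](scale0r (0 : series)) shuffleZr mul0r. Qed.

Lemma dletter_fone v : dletter v (fone V) = 0.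
Proof. by apply/funext. Qed.

Lemma shuffle_1l g s : shuffle (fone V) g s = g s.
Proof.
elim: s g => [|v s IH] g; first by rewrite /= mul1r.
have tw : twist (tag v) (fone V) = fone V.
  apply/funext => -[|u t]; rewrite /twist ?mulr0 //=.
  by rewrite wdeg_nil /koszul mulr0 expr0z mul1r.
by rewrite shuffle_cons tw IH dletter_fone shuffle0l add0r.
Qed.

Lemma shuffle_1r f c s : shuffle f (c *: (fone V : series)) s = f s * c.
Proof.
rewrite shuffleZr mulrC; congr (_ * _).
elim: s f => [|v s IH] f; first by rewrite /= mulr1.
by rewrite shuffle_cons IH dletter_fone shuffle0r addr0.
Qed.

Lemma derivation_one (Q : op1 V) : derivation Q -> Q 0 (fone V) = 0.
Proof.
move=> dQ; apply: fps_eq => s.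
have := dQ 0 0 (fone V) (fone V) s.
have e1 : Q _ (fone V \odot fone V) s = Q _ (fone V) s.
  rewrite -[RHS]/((fun p (u : fps V p) => Q p u s) 0 (fone V)).
  apply: fps_same => //.
  by move=> t; apply: shuffle_1l.
rewrite e1 /koszul mulr0 expr0z mul1r.
have e2 : (Q _ (fone V) \odot fone V) s = Q _ (fone V) s.
  rewrite /= -[X in shuffle _ X](scale1r (fone V : series)).
  by rewrite shuffle_1r mulr1.
have e3 : (fone V \odot Q _ (fone V)) s = Q _ (fone V) s by exact: shuffle_1l.
have zz (x : K) : x = x + x -> x = 0.
  by move=> xx; apply: (addIr x); rewrite add0r -xx.
by rewrite e2 e3 => /zz.
Qed.

End PowerSeriesAlgebra.

Section CovectorValued.
Variables (K : fieldType) (V W : int -> vectType K).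

Lemma cofps_eq n (f g : cofps V W n) : (forall s w, f s w = g s w) -> f = g.
Proof. by move=> fg; apply/val_inj/funext => s; apply/funext => w; exact: fg. Qed.

Lemma cofps_lin n a (f g : cofps V W n) s w : (a *: f + g) s w = a * f s w + g s w.
Proof. by []. Qed.

Lemma cofps_comb (X : lmodType K) (l : forall p, cofps V W p -> X)
    (l_linear : forall p, linear (l p)) p p1 p2 (f : cofps V W p)
    (f1 : cofps V W p1) (f2 : cofps V W p2) c :
  p1 = p -> p2 = p -> (forall s w, f s w = f1 s w + c * f2 s w) ->
  l p f = l p1 f1 + c *: l p2 f2.
Proof.
move=> p1p p2p E.
apply: (@lin_comb K (seq (letter V) * letter W) (OWalg V W)
  (fun p (u : cofps V W p) s => u s.1 s.2)) => //.
by move=> q u v uv; apply: cofps_eq => s w; exact: (uv (s, w)).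
Qed.

Lemma coact_linear_l p q (g : cofps V W q) : linear (fun f : fps V p => coact f g).
Proof.
move=> a f f'; apply: cofps_eq => s w; rewrite cofps_lin.
exact: (shuffle_linl a f f' (g^~ w)).
Qed.

Lemma coact_linear_r p q (f : fps V p) : linear (fun g : cofps V W q => coact f g).
Proof.
move=> a g g'; apply: cofps_eq => s w; rewrite cofps_lin.
exact: (shuffle_linr a f (g^~ w) (g'^~ w)).
Qed.

Lemma fmul_linear_l p q (g : fps V q) : linear (fun f : fps V p => f \odot g).
Proof. by move=> a f f'; apply: fps_eq => s; exact: (shuffle_linl a f f' g). Qed.

Lemma fmul_linear_r p q (f : fps V p) : linear (fun g : fps V q => f \odot g).
Proof. by move=> a g g'; apply: fps_eq => s; exact: (shuffle_linr a f g g'). Qed.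

End CovectorValued.

Section Pullbacks.
Variables (K : fieldType) (V W : int -> vectType K).
Variable h : forall n, {linear V n -> W n}.

Lemma shuffle_pull (f g : seq (letter W) -> K^o) s :
  shuffle f g (map (push h) s) =
  shuffle (fun t => f (map (push h) t)) (fun t => g (map (push h) t)) s.
Proof.
elim: s f g => [|v s IH] f g //; rewrite map_cons !shuffle_cons !IH.
congr (_ + shuffle _ _ _).
by apply/funext => t; rewrite /twist wdeg_push.
Qed.

Lemma pull_linear n : linear (pull h (n := n)).
Proof. by move=> a f g; apply/val_inj. Qed.

End Pullbacks.

Section Perp.
Variables (K : fieldType) (L : int -> vectType K) (A : forall n, {vspace L n}).

Definition retraction n : {linear L n -> subfam A n} := vsproj (A n).

Lemma jdual_linear n : linear (@jdual K L A n).
Proof. exact: pull_linear. Qed.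

Lemma Jmap_linear n : linear (@Jmap K L A n).
Proof. by move=> a f g; apply/val_inj. Qed.

Lemma jdualM p q (f : fps L p) (g : fps L q) :
  jdual A (f \odot g) = jdual A f \odot jdual A g.
Proof. by apply: fps_eq => s; exact: shuffle_pull. Qed.

(** [J] is a derivation along [j]; this is the product rule [Iuniv_mul] after
    restriction of the word to [A]. *)
Lemma JmapM p q (f : fps L p) (g : fps L q) s w :
  Jmap A (f \odot g) s w =
  coact (jdual A f) (Jmap A g) s w +
  koszul K p q * coact (jdual A g) (Jmap A f) s w.
Proof.
apply: etrans (Iuniv_mul f g (map (push (@Defs.incl K L A)) s) w) _; congr (_ + _ * _).
  exact: shuffle_pull.
exact: shuffle_pull.
Qed.

End Perp.

Lemma linear_fun_sum (K : fieldType) (U X : lmodType K) (l : U -> X) (hl : linear l)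
    I (r : seq I) (c_ : I -> K) (u_ : I -> U) :
  l (\sum_(i <- r) c_ i *: u_ i) = \sum_(i <- r) c_ i *: l (u_ i).
Proof.
pose F := GRing.isLinear.Build _ _ _ _ l hl.
pose m : {linear U -> X} := HB.pack l F.
rewrite -[l]/(m : U -> X) linear_sum.
by apply: eq_bigr => i _; rewrite linearZ.
Qed.

(** * Inverting the Euler operator *)

(** Let [a + b = 1] be a decomposition of [V] with [a b = 0].  The Euler operator
    [euler] is the derivation that extends the projection [b] on covectors; it
    multiplies by [k] the part of a form with exactly [k] arguments in the image
    of [b], so it is invertible on forms that vanish on the image of [a]. *)

Section EulerHomotopy.
Variables (K : fieldType) (V : int -> vectType K).
Variables a b : forall n, {linear V n -> V n}.
Hypothesis char0 : [pchar K] =i pred0.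
Hypothesis abE : forall n v, a n v + b n v = v.
Hypothesis ab0 : forall n v, a n (b n v) = 0.
Local Notation series := (seq (letter V) -> K^o).
Implicit Types f g h : series.

(** With [k = 0] this is the sum, over the sets [S] of positions of the word, of
    [1 / |S|] times the value of [f] after applying [b] on the positions in [S]
    and [a] elsewhere; in general [1 / (k + |S|)].  The inverse of [0] is [0],
    so the empty set does not contribute when [k = 0]. *)
Fixpoint euler_inv (k : nat) (f : series) (s : seq (letter V)) : K^o :=
  if s is v :: s' then
    euler_inv k (dletter (push a v) f) s' + euler_inv k.+1 (dletter (push b v) f) s'
  else k%:R^-1 * f [::].

Fixpoint euler (f : series) (s : seq (letter V)) : K^o :=
  if s is v :: s' then f (push b v :: s') + euler (dletter v f) s' else 0.

Lemma euler_inv_cons k f v s : euler_inv k f (v :: s) =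
  euler_inv k (dletter (push a v) f) s + euler_inv k.+1 (dletter (push b v) f) s.
Proof. by []. Qed.

Lemma dletter_lin f n c (u v : V n) : form_linear f ->
  dletter (vec (c *: u + v)) f = c *: dletter (vec u) f + dletter (vec v) f.
Proof. by move=> fl; apply/funext => t; apply: (fl [::]). Qed.

Lemma dletterZD v c f g : dletter v (c *: f + g) = c *: dletter v f + dletter v g.
Proof. by []. Qed.

Lemma euler_inv_lin k c f g :
  euler_inv k (c *: f + g) = c *: euler_inv k f + euler_inv k g.
Proof.
apply/funext => s; elim: s k f g => [|v s IH] k f g.
  by rewrite /= [(_ + _) _]/(c * f [::] + g [::]) mulrDr mulrCA.
rewrite [LHS]/= !dletterZD !IH.
rewrite [RHS]/(c * euler_inv k f (v :: s) + euler_inv k g (v :: s)) /= mulrDr.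
exact: addrACA.
Qed.

Lemma euler_inv_linear k f : form_linear f -> form_linear (euler_inv k f).
Proof.
move=> fl s1; elim: s1 k f fl => [|w s1 IH] k f fl s2 m c u v.
  rewrite !cat0s /= /push /= !linearP !dletter_lin // !euler_inv_lin.
  by rewrite scalerDr; exact: addrACA.
rewrite !cat_cons !euler_inv_cons.
rewrite (IH _ _ (dletter_linear _ fl)) (IH _ _ (dletter_linear _ fl)) scalerDr.
exact: addrACA.
Qed.

Lemma euler_inv0 k : euler_inv k 0 = 0.
Proof.
by have := euler_inv_lin k (-1) 0 0; rewrite scaler0 addr0 scaleN1r addNr.
Qed.

Lemma euler_invZ k c f : euler_inv k (c *: f) = c *: euler_inv k f.
Proof. by rewrite -[c *: f]addr0 euler_inv_lin euler_inv0 addr0. Qed.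

Lemma euler_inv_symmetric k f : form_symmetric f -> form_symmetric (euler_inv k f).
Proof.
move=> fs s1; elim: s1 k f fs => [|w s1 IH] k f fs u v s2; last first.
  rewrite !cat_cons !euler_inv_cons.
  rewrite (IH k _ (dletter_symmetric _ fs) u) (IH k.+1 _ (dletter_symmetric _ fs) u).
  by symmetry; exact: mulrDr.
have Ed x y : dletter y (dletter x f) =
    koszul K (tag x) (tag y) *: dletter x (dletter y f).
  by apply/funext => t; apply: (fs [::]).
rewrite !cat0s !euler_inv_cons.
rewrite (Ed (push a u) (push a v)) (Ed (push a u) (push b v)).
rewrite (Ed (push b u) (push a v)) (Ed (push b u) (push b v)) !euler_invZ.
rewrite -[RHS]/(koszul K (tag u) (tag v) *: (_ : K^o)) [RHS]scalerDr.
rewrite [X in _ = X + _]scalerDr [X in _ = _ + X]scalerDr.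
exact: addrACA.
Qed.

Lemma euler_inv_degree k n f : form_degree n f -> form_degree n (euler_inv k f).
Proof.
move=> fd s; elim: s k n f fd => [|v s IH] k n f fd ns /=.
  by rewrite fd ?mulr0.
have ns' : n + tag v + wdeg s != 0 by rewrite -addrA -wdeg_cons.
by rewrite (IH _ (n + tag v)) ?(IH _ (n + tag v)) ?addr0 //;
  exact: (dletter_degree (v := push _ v)).
Qed.

Lemma euler_inv_fps k n f : is_fps n f -> is_fps n (euler_inv k f).
Proof.
case=> fl fs fd; split; first exact: euler_inv_linear.
  exact: euler_inv_symmetric.
exact: euler_inv_degree.
Qed.

Lemma eulerD f g s : euler (f + g) s = euler f s + euler g s.
Proof.
elim: s f g => [|v s IH] f g /=; first by rewrite addr0.
have -> : dletter v (f + g) = dletter v f + dletter v g by [].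
by rewrite IH; exact: addrACA.
Qed.

Lemma char0_natr_neq0 k : k.+1%:R != 0 :> K.
Proof. by have /pcharf0P -> := char0. Qed.

Lemma push_ab v : push a (push b v) = vec (0 : V (tag v)).
Proof. by rewrite /push /= ab0. Qed.

Lemma bb n v : b n (b n v) = b n v.
Proof. by have := abE (b n v); rewrite ab0 add0r. Qed.

Lemma dletter0 n f : form_linear f -> dletter (vec (0 : V n)) f = 0.
Proof.
move=> fl; have := @dletter_lin f n (-1) 0 0 fl.
by rewrite scaler0 addr0 scaleN1r addNr.
Qed.

(** The induction needs all [k]: reading a letter through [b] moves from [k] to
    [k.+1].  The instance [k = 0] says that [euler] inverts [euler_inv 0] up to
    the restriction of [f] to the image of [a]. *)
Lemma euler_invK k f s : form_linear f ->
  euler (euler_inv k f) s + k%:R * euler_inv k f s =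
  f s - (if k is 0%N then f (map (push a) s) else 0).
Proof.
elim: s k f => [|v s IH] k f fl.
  rewrite /= add0r; case: k => [|k]; first by rewrite mul0r subrr.
  by rewrite mulrA divff ?char0_natr_neq0 // mul1r subr0.
have fE : f (v :: s) = dletter (push a v) f s + dletter (push b v) f s.
  case: v => n v; rewrite -[existT _ n v]/(vec v) -[in LHS](abE v).
  by have := fl [::] s n 1 (a n v) (b n v); rewrite !scale1r.
have dE : dletter v (euler_inv k f) =
    euler_inv k (dletter (push a v) f) + euler_inv k.+1 (dletter (push b v) f).
  by apply/funext.
have fa := dletter_linear (push a v) fl; have fb := dletter_linear (push b v) fl.
have pbb : push b (push b v) = push b v by rewrite /push /= bb.
have -> : euler (euler_inv k f) (v :: s) =
    euler_inv k f (push b v :: s) + euler (dletter v (euler_inv k f)) s by [].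
rewrite dE eulerD !euler_inv_cons push_ab dletter0 // euler_inv0 pbb add0r fE.
have IHa := IH k _ fa; have IHb := IH k.+1 _ fb.
rewrite subr0 -natr1 mulrDl mul1r in IHb.
have -> : (if k is 0 then f [seq push a i | i <- v :: s] else 0) =
    (if k is 0 then dletter (push a v) f [seq push a i | i <- s] else 0).
  by case: k {IHa IHb dE IH}.
rewrite [RHS]addrAC -IHa -IHb mulrDr.
have E (x A1 B1 ky kx : K) : x + (A1 + B1) + (ky + kx) = A1 + ky + (B1 + (kx + x)).
  by ring.
exact: E.
Qed.

End EulerHomotopy.

(** * The kernel of restriction is generated by covectors *)

Section Covectors.
Variables (K : fieldType) (V : int -> vectType K).
Local Notation series := (seq (letter V) -> K^o).

Definition on_degree n (l : V n -> K^o) (v : letter V) : K^o :=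
  l (component (F := fun m => V m) n v).

Lemma on_degreeE n (l : V n -> K^o) v : on_degree l (vec v) = l v.
Proof. by rewrite /on_degree component_eq. Qed.

Lemma on_degree_neq n (l : V n -> K^o) (v : letter V) :
  linear l -> tag v != n -> on_degree l v = 0.
Proof.
move=> hl nv; rewrite /on_degree component_neq //.
by have := hl (-1) 0 0; rewrite scaler0 addr0 scaleN1r addNr.
Qed.

Lemma on_degree_linear n (l : V n -> K^o) m : linear l ->
  linear (fun v : V m => on_degree l (vec v)).
Proof.
move=> hl c u v; rewrite /on_degree -hl.
by rewrite (component_linear (F := fun m => V m)).
Qed.

(** The series with linear part [l] and no other part. *)
Definition cov_series (l : letter V -> K^o) : series :=
  fun s => if s is [:: v] then l v else 0.

Lemma cov_series_fps n (l : letter V -> K^o) :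
  (forall m, linear (fun v : V m => l (vec v))) ->
  (forall v, n + tag v != 0 -> l v = 0) -> is_fps n (cov_series l).
Proof.
move=> ll ld; split.
- case=> [|w [|? ?]] [|? ?] m c u v //=; rewrite ?scaler0 ?addr0 //.
  exact: ll.
- by case=> [|w [|? ?]] u v s2; rewrite /= mulr0.
- by case=> [|v [|? ?]] //; rewrite wdeg_cons wdeg_nil addr0; exact: ld.
Qed.

Lemma fps_covector_ext n (x y : fps V n) : is_covector x -> is_covector y ->
  (forall v, x [:: v] = y [:: v]) -> x = y.
Proof.
move=> xc yc xy; apply: fps_eq => s.
by have [|s1] := eqVneq (size s) 1%N; [case: s => [|v []]|rewrite xc ?yc].
Qed.

Lemma symmetric_rcons (h : series) u s : form_symmetric h ->
  koszul K (tag u) (wdeg s) * h (rcons s u) = h (u :: s).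
Proof.
elim: s h => [|v s IH] h hs; first by rewrite wdeg_nil /koszul mulr0 expr0z mul1r.
rewrite (hs [::] u v s) /= wdeg_cons koszulDr -mulrA; congr (_ * _).
exact: (IH _ (dletter_symmetric v hs)).
Qed.

(** If the [x_ i] are the coordinates of [b] in the vectors [e_ i], then [euler]
    is the first order operator with coefficients [x_ i] and derivatives along
    the [e_ i].  The derivatives append their letter at the end of the word
    because the covectors stand on the right. *)
Lemma shuffle_covector (b : forall n, {linear V n -> V n}) I (r : seq I)
    (e_ : I -> letter V) (x_ : I -> series) (h : series) s :
  (forall i s, size s != 1%N -> x_ i s = 0) ->
  (forall h' s v, form_linear h' ->
     h' (rcons s (push b v)) = \sum_(i <- r) x_ i [:: v] * h' (rcons s (e_ i))) ->
  form_linear h -> form_symmetric h ->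
  \sum_(i <- r) shuffle (fun t => h (rcons t (e_ i))) (x_ i) s = euler b h s.
Proof.
move=> xc xE; elim: s h => [|v s IH] h hl hs.
  by rewrite big1 // => i _; rewrite /= xc ?mulr0.
under eq_bigr do rewrite shuffle_cons.
rewrite big_split /= addrC.
have dx i : dletter v (x_ i) = x_ i [:: v] *: (fone V : series).
  apply/funext => -[|u t]; first exact: (esym (mulr1 _)).
  by rewrite /dletter xc //; exact: (esym (mulr0 _)).
under eq_bigr do rewrite dx shuffle_1r.
congr (_ + _); last exact: (IH _ (dletter_linear v hl) (dletter_symmetric v hs)).
rewrite -(symmetric_rcons (push b v) s hs) xE // mulr_sumr.
by apply: eq_bigr => i _; rewrite /twist -mulrA (mulrC (h _)).
Qed.

End Covectors.

Section Hadamard.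
Variables (K : fieldType) (L : int -> vectType K) (A : forall n, {vspace L n}).
Hypothesis char0 : [pchar K] =i pred0.
Hypothesis finL : fin_dim L.

(* A projection onto [A] and its complement. *)
Let a n : {linear L n -> L n} := projv (A n).
Let b n : {linear L n -> L n} := (\1%VF - projv (A n))%R : 'End(L n).

Let abE n v : a n v + b n v = v.
Proof. by rewrite /a /b /= add_lfunE opp_lfunE id_lfunE addrC subrK. Qed.

Let aA n v : a n v \in A n.
Proof. exact: memv_proj. Qed.

Let bA n v : v \in A n -> b n v = 0.
Proof.
move=> vA; apply: (addrI (a n v)); rewrite abE addr0.
by rewrite /a /= projv_id.
Qed.

Let ab0 n v : a n (b n v) = 0.
Proof.
have /(congr1 (a n)) := abE v; rewrite linearD [a n (a n v)]projv_id ?aA //.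
by move/eqP; rewrite -subr_eq0 addrC addKr => /eqP.
Qed.

(* The index set of a basis of [L].  The covector [l_ i] is a coordinate of the
   [b]-part of a vector, so it vanishes on [A]; these covectors span [A^\perp]
   but are not linearly independent. *)
Let idx : Type := {n : int & 'I_(\dim {:L n})}.
Let e_ (i : idx) : letter L := vec (tnth (vbasis {:L (tag i)}) (tagged i)).
Let l_ (i : idx) : L (tag i) -> K^o :=
  fun v => coord (vbasis {:L (tag i)}) (tagged i) (b _ v).

Let l_linear i : linear (@l_ i).
Proof. by move=> c u v; rewrite /l_ !linearP. Qed.

Let x_fps i : is_fps (- tag i) (cov_series (on_degree (@l_ i))).
Proof.
apply: cov_series_fps => [m|v nv]; first exact: on_degree_linear.
by apply: on_degree_neq => //; move: nv; rewrite addrC subr_eq0.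
Qed.

Let x_covector i : is_covector (mkfps (x_fps i)).
Proof. by case=> [|v [|? ?]]. Qed.

Let x_jdual i : jdual A (mkfps (x_fps i)) = 0.
Proof.
apply: fps_eq => -[|v [|? ?]] //=.
have [vi|vi] := eqVneq (tag v) (tag i); last by rewrite on_degree_neq.
case: v i vi => n v [m i] /= vi; subst m.
rewrite on_degreeE /l_ /= bA ?linear0 //.
exact: subvsP.
Qed.

Let x_ i : perp A (- tag i) := Perp (x_covector i) (x_jdual i).

(* Expansion of [b v] in the basis; only finitely many degrees contribute. *)
Let basis_sum (r : seq int) (rP : forall n, \dim {:L n} != 0%N -> n \in r) (ur : uniq r)
    (h : seq (letter L) -> K^o) s v : form_linear h ->
  h (rcons s (push b v)) =
  \sum_(n <- r) \sum_(i < \dim {:L n})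
    cov_series (on_degree (@l_ (Tagged _ i))) [:: v] * h (rcons s (e_ (Tagged _ i))).
Proof.
move=> hl; case: v => m v; rewrite -[existT _ m v]/(vec v).
have hlin : linear (fun y : L m => h (rcons s (vec y))).
  by move=> c u w; have := hl s [::] m c u w; rewrite !cats1.
have main : h (rcons s (vec (b m v))) = \sum_(i < \dim {:L m})
    @l_ (Tagged _ i) v * h (rcons s (e_ (Tagged _ i))).
  rewrite [in LHS](coord_vbasis (memvf (b m v))).
  under eq_bigr => i _ do rewrite -tnth_nth.
  by rewrite (linear_fun_sum hlin).
have other n : n != m -> \sum_(i < \dim {:L n})
    on_degree (@l_ (Tagged _ i)) (vec v) * h (rcons s (e_ (Tagged _ i))) = 0.
  move=> nm; apply: big1 => i _.
  by rewrite on_degree_neq ?mul0r // eq_sym.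
have [mr|mr] := boolP (m \in r).
  rewrite (bigD1_seq m) //= [X in _ + X]big1 ?addr0 //.
  by rewrite [LHS]main; apply: eq_bigr => i _; rewrite on_degreeE.
rewrite big_seq big1 => [|n nr]; last first.
  by apply: other; apply: contraNneq mr => <-.
rewrite [LHS]main big1 // => i _.
have /eqP d0 : \dim {:L m} == 0%N by apply: contraNT mr => /rP.
by have := ltn_ord i; rewrite [X in (_ < X)%N]d0.
Qed.

(** Hadamard lemma.  If [f] vanishes on words in [A] then
    [f = euler (euler_inv 0 f)], and [euler] is a combination of derivatives
    with coefficients in [A^\perp].  Characteristic zero is used to invert the
    Euler operator, finite dimension to have a finite basis. *)
Lemma perp_generates n (f : fps L n) : jdual A f = 0 ->
  exists (I : Type) (r : seq I) (p_ q_ : I -> int) (g_ : forall i, fps L (p_ i))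
    (y_ : forall i, perp A (q_ i)),
    (forall i, p_ i + q_ i = n) /\
    forall s, f s = \sum_(i <- r) (g_ i \odot perp_val (y_ i)) s.
Proof.
move=> f0; have [fl fs fd] := fpsP f.
have [N finN] := finL.
(* The degrees from [- N] to [N] contain the support of [L]. *)
pose r := undup [seq (k%:Z - N%:Z) | k <- iota 0 (N + N).+1].
have rP m : \dim {:L m} != 0%N -> m \in r.
  move=> dm; rewrite mem_undup; have Nm : (`|m| <= N)%N.
    by rewrite leqNgt; apply: contra dm => /finN ->.
  by apply/mapP; exists `|(m + N%:Z)%R|%N; rewrite ?mem_iota; lia.
have ur : uniq r by exact: undup_uniq.
pose h := mkfps (euler_inv_fps a b 0 (fpsP f)).
have hl : form_linear h by case: (fpsP h).
have hs : form_symmetric h by case: (fpsP h).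
pose is_ : seq idx := flatten
  [seq [seq Tagged (fun n => 'I_(\dim {:L n})) i | i <- enum 'I_(\dim {:L n})] | n <- r].
have sumE (X : nmodType) (F : idx -> X) :
    \sum_(i <- is_) F i = \sum_(n <- r) \sum_(i < \dim {:L n}) F (Tagged _ i).
  rewrite big_flatten big_map; apply: eq_bigr => m _.
  by rewrite big_map big_enum.
have g_fps (i : idx) : is_fps (n + tag i) (fun t => h (rcons t (e_ i))).
  exact: ((cofpsP (Iuniv h)).1 (e_ i)).
exists idx, is_, (fun i => n + tag i), (fun i => - tag i),
  (fun i => mkfps (g_fps i)), x_; split=> [i|s]; first by rewrite addrK.
(* The projection onto [A] factors through the inclusion of [A]. *)
have fa : f (map (push a) s) = 0.
  have -> : map (push a) s =
      map (push (@Defs.incl K L A)) (map (push (@retraction K L A)) s).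
    rewrite -map_comp; apply: eq_map => -[m v].
    have vE : vsval (vsproj (A m) v) = projv (A m) v by rewrite unlock.
    by apply: (congr1 (fun u => vec u)); rewrite /= -vE.
  have := congr1 (fun u : fps (subfam A) n => u (map (push (@retraction K L A)) s)) f0.
  by [].
have := euler_invK char0 abE ab0 0 s fl.
rewrite mul0r addr0 fa subr0 => <-.
rewrite -(@shuffle_covector K L b idx is_ e_ (fun i => x_ i) h s) // => h' t v hl'.
by rewrite sumE (basis_sum rP ur).
Qed.

End Hadamard.

(** * The universal derivation on the kernel of restriction *)

Section KernelOfRestriction.
Variables (K : fieldType) (L : int -> vectType K) (A : forall n, {vspace L n}).

Lemma perp_vanish n (x : perp A n) m (v : L m) : v \in A m -> x [:: vec v] = 0.
Proof.
move=> vA; have := congr1 (fun u : fps (subfam A) n => u [:: vec (Subvs vA)]) (perp_jdual x).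
by [].
Qed.

(** A covector that vanishes on [A] is constant on the fibres of [L -> B], so its
    values on any choice of representatives define a covector of [B]. *)
Lemma perp_pull (B : int -> vectType K) (p : forall n, {linear L n -> B n}) n
    (x : perp A n) : quotient_map A p -> exists y : fps B n, pull p y = x.
Proof.
case=> p_surj p_ker; have [xl _ xd] := fpsP x.
have [sec secE] : {sec : forall m, B m -> L m | forall m u, p m (sec m u) = u}.
  by exists (fun m u => projT1 (cid (p_surj m u))) => m u; case: cid.
have x_eq m (u v : L m) : p m u = p m v -> x [:: vec u] = x [:: vec v].
  move=> uv; have uvA : u - v \in A m by rewrite -p_ker linearB uv subrr.
  rewrite -(subrK v u); have := xl [::] [::] m 1 (u - v) v.
  by rewrite !scale1r /= (perp_vanish x uvA) add0r.
pose l (u : letter B) : K^o := x [:: vec (sec _ (tagged u))].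
have yP : is_fps n (cov_series l).
  apply: cov_series_fps => [m c u v|u nu]; last first.
    by rewrite /l xd // wdeg_cons wdeg_nil addr0.
  rewrite /l /= -(xl [::] [::] m c); apply: x_eq.
  by rewrite linearP !secE.
exists (mkfps yP); apply: fps_covector_ext; last 1 first.
- move=> [m v]; rewrite /= /l /=; apply: x_eq; exact: secE.
- by case=> [|v [|? ?]].
- exact: perp_covector.
Qed.

Lemma coact0l (V W : int -> vectType K) p q (g : cofps V W q) : coact (0 : fps V p) g = 0.
Proof.
by apply: cofps_eq => s w; exact: (shuffle0l (g^~ w)).
Qed.
Lemma coact0r (V W : int -> vectType K) p q (f : fps V p) : coact f (0 : cofps V W q) = 0.
Proof.
by apply: cofps_eq => s w; exact: (shuffle0r f).
Qed.

Lemma cofps0 (V W : int -> vectType K) n s w : (0 : cofps V W n) s w = 0.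
Proof. by []. Qed.

Lemma Jmap_perp n (x : perp A n) w :
  (Jmap A x)^~ w = x [:: w] *: (fone (subfam A) : _ -> K^o).
Proof.
apply/funext => -[|v s]; first exact: (esym (mulr1 _)).
have -> : (x [:: w] *: (fone (subfam A) : _ -> K^o)) (v :: s) = 0 by exact: mulr0.
by apply: perp_covector; rewrite size_rcons.
Qed.

Lemma Jmap_mul_perp p q (g : fps L p) (x : perp A q) s w :
  Jmap A (g \odot x) s w = pure (jdual A g) x s w.
Proof.
rewrite JmapM perp_jdual coact0l mulr0 addr0 /= Jmap_perp.
exact: shuffle_1r.
Qed.

Section Derivations.
Variables (k : int) (d : int -> int) (T : forall n, {linear fps L n -> fps L (d n)}).
Hypothesis T_leibniz : forall p q (f : fps L p) (g : fps L q) s,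
  T _ (f \odot g) s = (T _ f \odot g) s + koszul K k p * (f \odot T _ g) s.

Lemma Jmap_T_mul p q (f : fps L p) (g : fps L q) s w :
  Jmap A (T _ (f \odot g)) s w =
  Jmap A (T _ f \odot g) s w + koszul K k p * Jmap A (f \odot T _ g) s w.
Proof. exact: T_leibniz. Qed.

Hypotheses (char0 : [pchar K] =i pred0) (finL : fin_dim L).

(** By [perp_generates] it is enough to treat [f = g . xi] with [xi] in
    [A^\perp]; each of the four terms of [J (T g . xi + g . T xi)] contains one of
    the vanishing factors [j (T g)], [j xi], [j (T xi)], [J (T xi)]. *)
Lemma Jmap_kernel (jT : forall n (f : fps L n), jdual A (T n f) = 0)
    (JT : forall n (x : perp A n), Jmap A (T n x) = 0) n (f : fps L n) :
  jdual A f = 0 -> Jmap A (T n f) = 0.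
Proof.
move=> /(perp_generates char0 finL)[I [r [p_ [q_ [g_ [y_ [pq fE]]]]]]].
apply: cofps_eq => s w.
rewrite (@fps_sum K L K^o (fun m u => Jmap A (T m u) s w : K^o) _ I r
  (fun i => p_ i + q_ i) (fun i => g_ i \odot y_ i)) //.
- apply: big1 => i _; rewrite Jmap_T_mul !JmapM !jT JT perp_jdual.
  by rewrite !coact0l !coact0r !cofps0 !(mulr0, addr0).
- by move=> m c u v; rewrite linearP Jmap_linear.
by elim: r {fE} => //= i r ->; rewrite pq eqxx.
Qed.

End Derivations.

Section Differential.
Variables (QL : op1 L) (QA : op1 (subfam A)).
Hypothesis QL_der : derivation QL.
Hypothesis QLA : forall n (f : fps L n), jdual A (QL _ f) = QA _ (jdual A f).

(** On the generators [g . xi] of the kernel, [J Q_L] is the differential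
    [Q_A + D^\perp] of the cochain [j g (x) xi = J (g . xi)]. *)
Lemma Jmap_Q_mul_perp p q (g : fps L p) (x : perp A q) s w :
  Jmap A (QL _ (g \odot x)) s w =
  pure (QA _ (jdual A g)) x s w +
  koszul K 1 p * coact (jdual A g) (Jmap A (QL _ x)) s w.
Proof.
rewrite (Jmap_T_mul QL_der) Jmap_mul_perp QLA; congr (_ + _ * _).
rewrite JmapM QLA perp_jdual linear0 coact0l.
by rewrite cofps0 mulr0 addr0.
Qed.

End Differential.

End KernelOfRestriction.

(** * Products of endomorphism-valued series *)

Lemma eq_big_all (X : nmodType) T (r : seq T) (P : pred T) (F G : T -> X) :
  all P r -> (forall i, P i -> F i = G i) -> \sum_(i <- r) F i = \sum_(i <- r) G i.
Proof.
move=> rP FG; elim: r rP => [|i r IH] /=; first by rewrite !big_nil.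
by case/andP=> Pi rP; rewrite !big_cons FG // IH.
Qed.

Section Quadrilinear.
Variables (K : fieldType) (U W U' W' : int -> lmodType K) (X : lmodType K).

Definition quad_family
    (m : forall p q p' q', U p -> W q -> U' p' -> W' q' -> X) : Prop :=
  (forall p' q' u' w', bilinear_family (fun p q u w => m p q p' q' u w u' w')) /\
  (forall p q u w, bilinear_family (fun p' q' u' w' => m p q p' q' u w u' w')).

Variable m : forall p q p' q', U p -> W q -> U' p' -> W' q' -> X.

(** The evaluation of a pair of tensors; the products of tensors used below are
    all instances of it. *)
Definition tsum2 (x : tens U W) (y : tens U' W') : X :=
  tsum (fun p q u w => tsum (fun p' q' u' w' => @m p q p' q' u w u' w') y) x.

Lemma tsum2_exchange x y : tsum2 x y =
  tsum (fun p' q' u' w' => tsum (fun p q u w => @m p q p' q' u w u' w') x) y.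
Proof. exact: exchange_big. Qed.

Lemma tsum2_catl x x' y : tsum2 (x ++ x') y = tsum2 x y + tsum2 x' y.
Proof. exact: tsum_cat. Qed.

Lemma tsum2_catr x y y' : tsum2 x (y ++ y') = tsum2 x y + tsum2 x y'.
Proof. by rewrite tsum2_exchange tsum_cat -!tsum2_exchange. Qed.

Hypothesis hm : quad_family m.

Lemma quad_tsum_l y :
  bilinear_family (fun p q u w => tsum (fun p' q' u' w' => @m p q p' q' u w u' w') y).
Proof.
split=> p q u a v w; rewrite /tsum scaler_sumr -big_split; apply: eq_bigr => t _.
  exact: (hm.1 _ _ _ _).1.
exact: (hm.1 _ _ _ _).2.
Qed.

Lemma quad_tsum_r x :
  bilinear_family (fun p' q' u' w' => tsum (fun p q u w => @m p q p' q' u w u' w') x).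
Proof.
split=> p q u a v w; rewrite /tsum scaler_sumr -big_split; apply: eq_bigr => t _.
  exact: (hm.2 _ _ _ _).1.
exact: (hm.2 _ _ _ _).2.
Qed.

Lemma tsum2_teq x x' y y' : x =t x' -> y =t y' -> tsum2 x y = tsum2 x' y'.
Proof.
move=> xx yy; rewrite [LHS](xx _ _ (quad_tsum_l y)) -[LHS]/(tsum2 x' y).
by rewrite !tsum2_exchange; exact: (yy _ _ (quad_tsum_r x')).
Qed.

Lemma tsum2_nill y : tsum2 [::] y = 0.
Proof. exact: big_nil. Qed.
Lemma tsum2_nilr x : tsum2 x [::] = 0.
Proof. by rewrite tsum2_exchange; exact: big_nil. Qed.

Lemma tsum2_scalel c x y : tsum2 (tscale c x) y = c *: tsum2 x y.
Proof. exact: tsum_scale (quad_tsum_l y). Qed.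

Lemma tsum2_scaler c x y : tsum2 x (tscale c y) = c *: tsum2 x y.
Proof. by rewrite !tsum2_exchange; exact: tsum_scale (quad_tsum_r x). Qed.

End Quadrilinear.

Section Endomorphisms.
Variables (K : fieldType) (E : int -> lmodType K).

Lemma gcomp_linear_l k l (g : gend E l) : linear (fun f : gend E k => gcomp f g).
Proof. by move=> a f f'; apply: gend_eq. Qed.

Lemma gcomp_linear_r k l (f : gend E k) : linear (fun g : gend E l => gcomp f g).
Proof. by move=> a g g'; apply: gend_eq => n m e x; exact: gend_linear. Qed.

(** As for power series, composites are compared only through their values. *)
Lemma gend_same (X : Type) (l : forall k, gend E k -> X) k k' (f : gend E k) (f' : gend E k') :
  k = k' -> (forall n m e e' x, f n m e x = f' n m e' x) -> l k f = l k' f'.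
Proof. by move=> kk; subst k' => ff; congr l; apply: gend_eq. Qed.

Lemma gcompA_same (X : Type) (l : forall k, gend E k -> X) k1 k2 k3
    (f : gend E k1) (g : gend E k2) (h : gend E k3) :
  l _ (gcomp (gcomp f g) h) = l _ (gcomp f (gcomp g h)).
Proof.
apply: gend_same => [|n m e e' x]; first by rewrite addrA.
have gE N (e1 : N = n + k3 + k2) (e2 : m = N + k1) e3 y :
    f _ m e3 (g _ _ erefl y) = f N m e2 (g _ N e1 y).
  by subst N; rewrite (Prop_irrelevance e2 e3).
exact: gE.
Qed.

End Endomorphisms.

Section TensorAlgebra.
Variables (K : fieldType) (V : int -> vectType K) (E : int -> lmodType K).
Local Notation OV := (Oalg V).
Local Notation EE := (EndAlg E).
Local Notation OE := (tens OV EE).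
Variables (X : lmodType K) (b : forall p q, OV p -> EE q -> X).
Hypothesis hb : bilinear_family b.

Definition mul_test p q p' q' (u : OV p) (w : EE q) (u' : OV p') (w' : EE q') : X :=
  b (koszul K q p' *: ((u : fps V p) \odot (u' : fps V p'))) (gcomp w w' : EE (q + q')).

Lemma mul_test_quad : quad_family mul_test.
Proof.
split=> p q u w; split=> p' q' v a v1 v2; rewrite /mul_test !(bilZl hb).
- by rewrite fmul_linear_l (bilPl hb) scalerDr !scalerA mulrC.
- by rewrite gcomp_linear_l (bilPr hb) scalerDr !scalerA mulrC.
- by rewrite fmul_linear_r (bilPl hb) scalerDr !scalerA mulrC.
- by rewrite gcomp_linear_r (bilPr hb) scalerDr !scalerA mulrC.
Qed.

Lemma tsum_mul (x y : OE) : tsum b (tmul x y) = tsum2 mul_test x y.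
Proof. by rewrite /tsum /tmul big_allpairs_dep. Qed.

Lemma tsum_mulA (x y z : OE) : tsum b (tmul (tmul x y) z) = tsum b (tmul x (tmul y z)).
Proof.
rewrite /tmul /tsum !big_allpairs_dep; apply: eq_bigr => s _.
rewrite [RHS]big_allpairs_dep; apply: eq_bigr => t _; apply: eq_bigr => r _ /=.
case: s t r => [[p1 f] [q1 e]] [[p2 g] [q2 e2]] [[p3 h] [q3 e3]] /=.
have Zl c p q (u : fps V p) (v : fps V q) : (c *: u) \odot v = c *: (u \odot v).
  by apply: fps_eq => w; exact: (shuffleZl c u v).
have Zr c p q (u : fps V p) (v : fps V q) : u \odot (c *: v) = c *: (u \odot v).
  by apply: fps_eq => w; exact: (shuffleZr c u v).
rewrite Zl Zr !(bilZl hb) !scalerA koszulDl koszulDr.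
congr (_ *: _); first by ring.
rewrite (gcompA_same (fun k (w : gend E k) => b (f \odot g \odot h) w)).
apply: (fps_same (fun p (u : fps V p) => b u _)); first by rewrite addrA.
by move=> w; exact: shuffleA.
Qed.

End TensorAlgebra.

Section TensorDerivations.
Variables (K : fieldType) (V : int -> vectType K) (E : int -> lmodType K).
Local Notation OV := (Oalg V).
Local Notation EE := (EndAlg E).
Local Notation OE := (tens OV EE).
Variables (k : int) (d : int -> int) (T : forall n, {linear fps V n -> fps V (d n)}).
Hypothesis dE : forall n, d n = n + k.
Local Notation Tmap := (tmap (U := OV) (U' := OV) (W := EE) T).

Lemma tdegree_map n (x : OE) : tdegree n x -> tdegree (n + k) (Tmap x).
Proof.
rewrite /tdegree all_map; apply: sub_all => t /= /eqP <-.
by rewrite dE addrAC.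
Qed.

Hypothesis T_leibniz : forall p q (f : fps V p) (g : fps V q) s,
  T _ (f \odot g) s = (T _ f \odot g) s + koszul K k p * (f \odot T _ g) s.

(** The sign of moving [T] past the endomorphism part of the first factor comes
    from the total degree [n] on the right and is cancelled by the shift of
    degree of the second factor in the sign of the product. *)
Lemma tsum_leibniz (X : lmodType K) (b : forall p q, OV p -> EE q -> X)
    (hb : bilinear_family b) n (x y : OE) : tdegree n x ->
  tsum b (Tmap (tmul x y)) =
  tsum b (tmul (Tmap x) y) + koszul K k n *: tsum b (tmul x (Tmap y)).
Proof.
move=> xn; rewrite tsum_map !(tsum_mul b) /tsum2 /tsum /tmul big_allpairs_dep.
rewrite /tmap !big_map scaler_sumr -big_split /=.
apply: (eq_big_all xn) => s /eqP <-.
rewrite big_map scaler_sumr -big_split; apply: eq_bigr => t _ /=.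
rewrite /mul_test linearZ !(bilZl hb).
set w := gcomp _ _.
have bT : forall p, linear (fun u : fps V p => b p _ u w).
  by move=> p c u v; exact: (bilPl hb).
rewrite (fps_comb bT _ _ (T_leibniz _ _)); last 2 first.
- by rewrite !dE addrAC.
- by rewrite !dE addrA.
rewrite scalerDr !scalerA; congr (_ + _ *: _).
rewrite dE !koszulDr (koszulC K k (tag s.2)).
have := koszul_sq K (tag s.2) k; move: (koszul K _ k) => a aa.
by rewrite mulrACA aa mulr1 mulrC.
Qed.

End TensorDerivations.

Section TensorDegree.
Variables (K : fieldType) (V : int -> vectType K) (E : int -> lmodType K).
Local Notation OE := (tens (Oalg V) (EndAlg E)).

Lemma tdegree_cat n (x y : OE) : tdegree n x -> tdegree n y -> tdegree n (x ++ y).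
Proof. by rewrite /tdegree all_cat => -> ->. Qed.

Lemma tdegree_scale n c (x : OE) : tdegree n x -> tdegree n (tscale c x).
Proof. by rewrite /tdegree all_map. Qed.

Lemma tdegree_mul m n (x y : OE) :
  tdegree m x -> tdegree n y -> tdegree (m + n) (tmul x y).
Proof.
rewrite /tdegree => xm yn; elim: x xm => [|s x IH] //= /andP[/eqP sm xm].
rewrite all_cat IH // andbT all_map; apply: sub_all yn => t /= /eqP tn.
by rewrite -sm -tn addrACA.
Qed.

End TensorDegree.

Section RestrictedDerivation.
Variables (K : fieldType) (L : int -> vectType K) (A : forall n, {vspace L n}).
Variable E : int -> lmodType K.
Local Notation OA := (Oalg (subfam A)).
Local Notation OL := (Oalg L).
Local Notation OAL := (OWalg (subfam A) L).
Local Notation EE := (EndAlg E).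
Local Notation jmap := (tmap (U := OL) (U' := OA) (W := EE) (@jdual K L A)).
Local Notation JJ := (tmap (U := OL) (U' := OAL) (W := EE) (@Jmap K L A)).

Lemma JJ_teq x y : x =t y -> JJ x =t JJ y.
Proof. by apply: teq_map => p; exact: Jmap_linear. Qed.

Section Test.
Variables (X : lmodType K) (b : forall p q, OAL p -> EE q -> X).
Hypothesis hb : bilinear_family b.

(** [lact_test] and [ract_test] evaluate the left and the right product of an
    [L^\vee]-valued tensor with an element of [O(A) (x) End(E)]; in the right
    product the series is moved to the left, hence the second sign. *)
Definition lact_test p q p' q' (u : OA p) (w : EE q) (g : OAL p') (w' : EE q') : X :=
  b (koszul K q p' *: (coact (u : fps _ p) (g : cofps _ _ p') : OAL _)) (gcomp w w' : EE (q + q')).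

Definition ract_test p' q' p q (g : OAL p') (w' : EE q') (u : OA p) (w : EE q) : X :=
  b ((koszul K q' p * koszul K p' p) *: (coact (u : fps _ p) (g : cofps _ _ p') : OAL _))
    (gcomp w' w : EE (q' + q)).

Lemma lact_quad : quad_family lact_test.
Proof.
split=> p q u w; split=> p' q' v a v1 v2; rewrite /lact_test !(bilZl hb).
- by rewrite coact_linear_l (bilPl hb) scalerDr !scalerA mulrC.
- by rewrite gcomp_linear_l (bilPr hb) scalerDr !scalerA mulrC.
- by rewrite coact_linear_r (bilPl hb) scalerDr !scalerA mulrC.
- by rewrite gcomp_linear_r (bilPr hb) scalerDr !scalerA mulrC.
Qed.

Lemma ract_quad : quad_family ract_test.
Proof.
split=> p q u w; split=> p' q' v a v1 v2; rewrite /ract_test !(bilZl hb).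
- by rewrite coact_linear_r (bilPl hb) scalerDr !scalerA mulrC.
- by rewrite gcomp_linear_l (bilPr hb) scalerDr !scalerA mulrC.
- by rewrite coact_linear_l (bilPl hb) scalerDr !scalerA mulrC.
- by rewrite gcomp_linear_r (bilPr hb) scalerDr !scalerA mulrC.
Qed.

(** [JmapM] with coefficients in [End(E)]. *)
Lemma tsum_JJ_mul x y : tsum b (JJ (tmul x y)) =
  tsum2 lact_test (jmap x) (JJ y) + tsum2 ract_test (JJ x) (jmap y).
Proof.
rewrite tsum_map /tsum2 /tsum /tmul big_allpairs_dep /tmap !big_map -big_split.
apply: eq_bigr => s _; rewrite !big_map -big_split; apply: eq_bigr => t _ /=.
rewrite /lact_test /ract_test.
set w := gcomp _ _.
have JE c p (u : fps L p) : Jmap A (c *: u) = c *: Jmap A u.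
  by apply: cofps_eq.
rewrite JE !(bilZl hb) -scalerA -scalerDr; congr (_ *: _).
have bT : forall p, linear (fun u : cofps (subfam A) L p => b u w).
  by move=> p c u v; exact: (bilPl hb).
exact: (cofps_comb bT _ (addrC _ _) (JmapM _ _)).
Qed.

Lemma tsum_tcomm n D z : tdegree 1 D -> tdegree n z ->
  tsum b (tcomm D z) =
  tsum2 lact_test D z - koszul K 1 n *: tsum2 ract_test z D.
Proof.
move=> D1 zn; rewrite [tsum2 ract_test _ _]tsum2_exchange /tsum2 /tsum /tcomm.
rewrite big_flatten big_allpairs_dep scaler_sumr -sumrB /=.
apply: (eq_big_all D1) => s /eqP s1; rewrite scaler_sumr -sumrB.
apply: (eq_big_all zn) => t /eqP tn.
rewrite big_cons big_seq1 /=; congr (_ + _).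
rewrite /ract_test !(bilZl hb) s1 tn scaleNr scalerA; congr (- (_ *: _)).
by rewrite -tn koszulDl mulrA mulrAC -mulrA.
Qed.

End Test.
End RestrictedDerivation.

(** * Flatness of modules *)

Section Separation.
Variables (K : fieldType) (S : Type).

(** Evaluations that separate the points of [U] also separate those of the
    tensor product with [W].  If [u] is nonzero at some [s0], the relation at
    [s0] expresses [w] through the other terms; substituting removes one term,
    and the induction applies to the shorter sum. *)
Lemma evaluations_separate (U W X : lmodType K) (ev : U -> S -> K)
    (ev_linear : forall a (u v : U) s, ev (a *: u + v) s = a * ev u s + ev v s)
    (ev_inj : forall u, (forall s, ev u s = 0) -> u = 0)
    (b : U -> W -> X) (bl : forall w, linear (b^~ w)) (br : forall u, linear (b u))
    (r : seq (U * W)) :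
  (forall s, \sum_(t <- r) ev t.1 s *: t.2 = 0) -> \sum_(t <- r) b t.1 t.2 = 0.
Proof.
have [n] := ubnP (size r); elim: n r => // n IH [|[u w] r]; first by rewrite big_nil.
rewrite /= ltnS => rn E; rewrite big_cons /=.
have Es s : ev u s *: w = - \sum_(t <- r) ev t.1 s *: t.2.
  by apply/eqP; rewrite -addr_eq0; have := E s; rewrite big_cons => ->.
have b0 v : b 0 v = 0 by have := bl v (-1) 0 0; rewrite scaler0 addr0 scaleN1r addNr.
have [u0|/existsNP[s0 /eqP us0]] := pselect (forall s, ev u s = 0).
  rewrite (ev_inj _ u0) b0 add0r; apply: (IH _ rn) => s.
  by have := E s; rewrite big_cons /= u0 scale0r add0r.
pose c (t : U * W) := ev t.1 s0 / ev u s0.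
have wE : w = - \sum_(t <- r) c t *: t.2.
  rewrite -[LHS]scale1r -(mulVf us0) -scalerA Es scalerN scaler_sumr; congr (- _).
  by apply: eq_bigr => t _; rewrite scalerA mulrC.
pose f (t : U * W) := (- c t *: u + t.1, t.2).
have : \sum_(t <- map f r) b t.1 t.2 = 0.
  apply: IH => [|s]; first by rewrite size_map.
  rewrite big_map /=; under eq_bigr do rewrite ev_linear scalerDl.
  rewrite big_split /= -[RHS](E s) big_cons /=; congr (_ + _).
  rewrite wE scalerN scaler_sumr -sumrN; apply: eq_bigr => t _.
  by rewrite scalerA mulrC -scaleNr mulrN.
rewrite big_map => Ef; rewrite -[RHS]Ef [in RHS]/f /=.
under [in RHS]eq_bigr do rewrite bl.
rewrite big_split /=; congr (_ + _).
have -> : w = \sum_(t <- r) (- c t) *: t.2.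
  by rewrite wE -sumrN; apply: eq_bigr => t _; rewrite scaleNr.
exact: (linear_fun_sum (br u)).
Qed.

(** The homogeneous components of a tensor are treated separately. *)
Lemma teq0_evaluations (U W : int -> lmodType K) (ev : forall p, U p -> S -> K)
    (ev_linear : forall p a (u v : U p) s, ev p (a *: u + v) s = a * ev p u s + ev p v s)
    (ev_inj : forall p (u : U p), (forall s, ev p u s = 0) -> u = 0) (x : tens U W) :
  (forall p q s, \sum_(t <- x) ev p (component p t.1) s *: component q t.2 = 0) ->
  x =t [::].
Proof.
move=> E X b hb; rewrite tsum_nil.
pose tags (t : homog (fun n => U n) * homog (fun n => W n)) := (tag t.1, tag t.2).
pose r := undup (map tags x).
have -> : tsum b x = \sum_(pq <- r) \sum_(t <- x)
    b pq.1 pq.2 (component pq.1 t.1) (component pq.2 t.2).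
  rewrite exchange_big /tsum; apply: (eq_big_all (P := fun t => tags t \in r)).
    have : {subset map tags x <= r} by move=> t; rewrite mem_undup.
    elim: (x) => //= t y IH sub; rewrite sub ?mem_head //=.
    by apply: IH => z zy; apply: sub; rewrite in_cons zy orbT.
  move=> t tr; rewrite (bigD1_seq (tags t)) ?undup_uniq //= big1 ?addr0.
    by case: t {tr} => [[p u] [q w]] /=; rewrite !component_eq.
  move=> [p q]; rewrite xpair_eqE negb_and => /orP[] /= pq.
    by rewrite component_neq ?(bil0l hb) // eq_sym.
  by rewrite [component q _]component_neq ?(bil0r hb) // eq_sym.
apply: big1 => -[p q] _ /=.
rewrite -(big_map (fun t => (component p t.1, component q t.2)) xpredT
  (fun t => b p q t.1 t.2)).
apply: (evaluations_separate (@ev_linear p) (@ev_inj p) (hb.1 p q) (hb.2 p q)) => s.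
by rewrite big_map.
Qed.

End Separation.

Section FlatModules.
Variables (K : fieldType) (V : int -> vectType K) (E : int -> lmodType K).
Local Notation OV := (Oalg V).
Local Notation EE := (EndAlg E).

(** Both sides are [f] at [x] if the degrees of source and target differ by [k],
    and zero otherwise. *)
Lemma component_gend n m k (f : gend E k) x q (e : m = n + q) :
  (component (F := EE) q (hel (T := fun k => EE k) f) : gend E q) n m e x =
  component m (hel (T := fun m => E m) (f n (n + k) erefl x)).
Proof.
have [kq|kq] := eqVneq k q.
  by subst q; rewrite (component_eq (F := EE)); subst m; rewrite component_eq.
rewrite (component_neq (F := EE)) // component_neq //.
by rewrite e /= (inj_eq (addrI n)).
Qed.

Lemma component_gapp k N M (f : gend E k) (e : M = N + k) m y :
  component m (hel (T := fun m => E m) (f N M e y)) =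
  component m (hel (T := fun m => E m) (gapp f y)).
Proof. by subst M. Qed.

Lemma gend_sum T (r : seq T) k (F : T -> gend E k) n m e x :
  (\sum_(t <- r) F t) n m e x = \sum_(t <- r) F t n m e x.
Proof.
by elim: r => [|t r IH]; rewrite ?big_nil // !big_cons -IH.
Qed.

Variables (Q : op1 V) (D : tens OV EE).

(** The square of [Q + D], applied to [1 (x) e], is the value at [e] of
    [Q D + D^2], since [Q 1 = 0].  Vanishing of all these values gives a
    vanishing tensor by [teq0_evaluations], also when [E] is infinite-dimensional. *)
Lemma module_flat : derivation Q -> is_module Q D -> tmap Q D ++ tmul D D =t [::].
Proof.
move=> dQ [D1 DD].
apply: (@teq0_evaluations K (seq (letter V)) OV EE (fun p (u : fps V p) s => u s)).
- by [].
- by move=> p u u0; apply: fps_eq.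
move=> p q s; apply: gend_eq => n m e x; rewrite gend_sum /=.
(* Evaluation of an element of [O(V) (x) E] at the word [s], in degree [m]. *)
pose b p' m' (u : OV p') (y : E m') : E m :=
  (component (F := OV) p (hel (T := fun p => OV p) u) : fps V p) s *:
  component m (hel (T := fun m => E m) y).
have bl p' m' (y : E m') : linear (fun u : OV p' => b _ _ u y).
  move=> c u v; rewrite /b component_linear scalerA.
  rewrite -scalerDl; congr (_ *: _); exact: fps_lin.
have br p' m' (u : OV p') : linear (fun y : E m' => b _ _ u y).
  by move=> c y z; rewrite /b component_linear scalerDr !scalerA mulrC.
have hb : bilinear_family b by split=> *; [exact: bl|exact: br].
have bE k p' (u : fps V p') (f : gend E k) :
    (component (F := OV) p (hel (T := fun p => OV p) (u : OV p')) : fps V p) s *: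
    (component (F := EE) q (hel (T := fun q => EE q) (f : EE k)) : gend E q) n m e x =
    b p' (n + k) u (gapp f x).
  by rewrite component_gend.
have DD0 := DD [:: tpure OV E (fone V) x] _ b hb.
rewrite tsum_nil in DD0; rewrite -[RHS]DD0.
(* [b1] is [b] after one application of [Q + D]. *)
pose b1 p' m' (u : OV p') (y : E m') := b _ _ (Q p' u) y +
  \sum_(d <- D) b _ _ (koszul K 1 p' *: ((u : fps V p') \odot tagged d.1)) (gapp (tagged d.2) y).
have step y : tsum b (module_diff Q D y) = tsum b1 y.
  rewrite /tsum /module_diff big_flatten big_map; apply: eq_bigr => t _.
  by rewrite big_cons big_map.
rewrite step {1}/tsum /module_diff /= cats0 big_cons /= derivation_one //.
have -> : b1 (0 + 1) n (0 : fps V _) x = 0.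
  rewrite /b1 linear0 (bil0l hb) add0r big1 // => d _.
  have -> : (0 : fps V (0 + 1)) \odot tagged d.1 = 0.
    by apply: fps_eq => w; exact: shuffle0l.
  by rewrite scaler0 (bil0l hb).
rewrite add0r big_map big_cat big_map /tmul big_allpairs_dep /=.
rewrite [X in _ + X]exchange_big -big_split /=.
apply: (eq_big_all D1) => d /eqP d1 /=.
have -> : b1 (0 + tag d.1) (n + tag d.2)
    (koszul K 1 0 *: (fone V \odot tagged d.1)) (gapp (tagged d.2) x) =
    b1 (tag d.1) (n + tag d.2) (tagged d.1) (gapp (tagged d.2) x).
  apply: (fps_same (fun p u => b1 p _ u _)); first by rewrite add0r.
  move=> w; rewrite /koszul mulr0 expr0z scale1r; exact: shuffle_1l.
rewrite /b1 bE; congr (_ + _); apply: (eq_big_all D1) => d' /eqP d'1.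
rewrite bE /b -[gapp (gcomp _ _) x]/(tagged d'.2 _ _ _ (gapp (tagged d.2) x)).
rewrite component_gapp; congr (_ *: _).
apply: (fps_same (fun p' u => (component (F := OV) p (hel (T := fun p => OV p) u) : fps V p) s)).
  by rewrite addrC.
(* In [Q + D] the series of the outer factor stands on the right; commuting the
   series turns its sign into the sign of the product since [D] has degree 1. *)
move=> w; have [_ _ fd] := fpsP (tagged d.1); have [_ _ fd'] := fpsP (tagged d'.1).
rewrite -[LHS]/(_ * shuffle _ _ w) (shuffleC _ fd' fd) mulrA -koszulDl.
by rewrite [tag d'.2 + _]addrC d'1.
Qed.

End FlatModules.

(** * Cochains from the kernel of restriction *)

Section KernelTensors.
Variables (K : fieldType) (L : int -> vectType K) (A : forall n, {vspace L n}).
Variable E : int -> lmodType K.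
Local Notation OA := (Oalg (subfam A)).
Local Notation OL := (Oalg L).
Local Notation OAL := (OWalg (subfam A) L).
Local Notation EE := (EndAlg E).
Local Notation jmap := (tmap (U := OL) (U' := OA) (W := EE) (@jdual K L A)).
Local Notation JJ := (tmap (U := OL) (U' := OAL) (W := EE) (@Jmap K L A)).

(** The projection onto the kernel of [j] along the image of a section of [j].
    It turns a tensor in the kernel of [j (x) 1] into an equal one whose terms
    lie in the kernel of [j]. *)
Definition kernel_part n (f : fps L n) : fps L n :=
  f - pull (@retraction K L A) (jdual A f).

Lemma jdual_kernel_part n (f : fps L n) : jdual A (kernel_part f) = 0.
Proof.
apply: fps_eq => s.
have -> : jdual A (kernel_part f) s = f (map (push (@Defs.incl K L A)) s) -
    f (map (push (@Defs.incl K L A)) (map (push (@retraction K L A))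
      (map (push (@Defs.incl K L A)) s))) by [].
have -> : map (push (@retraction K L A)) (map (push (@Defs.incl K L A)) s) = s.
  rewrite -map_comp -[RHS]map_id; apply: eq_map => -[m v].
  by apply: (congr1 (fun u => vec u)); exact: vsvalK.
exact: subrr.
Qed.

Local Notation kmap := (tmap (U := OL) (U' := OL) (W := EE) kernel_part).

Lemma kernel_part_teq x : jmap x =t [::] -> kmap x =t x.
Proof.
move=> jx X b hb; rewrite tsum_map.
have := teq_map (T := fun n => @pull K L (subfam A) (@retraction K L A) n)
  (fun n => @pull_linear K L (subfam A) (@retraction K L A) n) jx hb.
rewrite tsum_nil tsum_map tsum_map => E0.
rewrite -[RHS]subr0 -{1}E0 /tsum -sumrB; apply: eq_bigr => t _.
rewrite /kernel_part -[X in b _ _ (_ - X)]scale1r -scaleNr addrC (bilPl hb).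
by rewrite scaleN1r addrC.
Qed.

Section Kill.
Variables (d : int -> int) (T : forall n, {linear fps L n -> fps L (d n)}).
Hypothesis T_kernel : forall n (f : fps L n), jdual A f = 0 -> Jmap A (T n f) = 0.

(** The hypothesis on [T] concerns single series, and a tensor in the kernel of
    [j (x) 1] is equal to its image under [kernel_part]. *)
Lemma JJ_kernel x : jmap x =t [::] ->
  JJ (tmap (U := OL) (U' := OL) (W := EE) T x) =t [::].
Proof.
move=> jx X b hb; rewrite tsum_nil.
have T_linear p : linear (fun u : OL p => T p u : OL (d p)).
  by move=> c u v; exact: linearP.
rewrite -(JJ_teq (teq_map T_linear (kernel_part_teq jx)) hb).
rewrite !tsum_map /tsum big1 // => t _.
by rewrite T_kernel ?jdual_kernel_part ?(bil0l hb).
Qed.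
End Kill.

Variables (QL : op1 L) (QA : op1 (subfam A)) (DAE : tens OA EE).
Hypotheses (char0 : [pchar K] =i pred0) (finL : fin_dim L).
Hypothesis QL_der : derivation QL.
Hypothesis QLA : forall n (f : fps L n), jdual A (QL _ f) = QA _ (jdual A f).
Hypothesis DAE1 : tdegree 1 DAE.
Local Notation QLmap := (tmap (U := OL) (U' := OL) (W := EE) QL).

(** The part [Q_A + D^\perp] of the differential. *)
Definition cdiff_untwisted (c : cochain A E) : tens OAL EE := cdiff QL QA [::] c.

Lemma tsum_cdiff_untwisted (X : lmodType K) (b : forall p q, OAL p -> EE q -> X) c :
  tsum b (cdiff QL QA DAE c) = tsum b (cdiff_untwisted c) + tsum b (tcomm DAE (cembed c)).
Proof.
rewrite /cdiff_untwisted /cdiff !tsum_cat.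
by rewrite [in RHS](_ : tcomm [::] _ = [::]) // tsum_nil addr0 addrA.
Qed.

(** The generators of [perp_generates] write [f] as a sum of products [g . xi],
    and the cochain is the sum of the [j g (x) xi (x) w]. *)
Lemma cochain_of_tensor n (f : fps L n) k (w : gend E k) :
  jdual A f = 0 -> exists c : cochain A E, [/\ cdegree (n + k) c,
    forall (X : lmodType K) (b : forall p q, OAL p -> EE q -> X), bilinear_family b ->
      tsum b (cembed c) = b n k (Jmap A f) w &
    forall (X : lmodType K) (b : forall p q, OAL p -> EE q -> X), bilinear_family b ->
      tsum b (cdiff_untwisted c) = b (n + 1) k (Jmap A (QL n f)) w].
Proof.
move=> /(perp_generates char0 finL)[I [r [p_ [q_ [g_ [y_ [pq fE]]]]]]].
have rP : all (fun i => p_ i + q_ i == n) r.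
  by elim: r {fE} => //= i r ->; rewrite pq eqxx.
pose c : cochain A E := [seq (hel (T := fun n => OA n) (jdual A (g_ i)),
  hel (T := fun n => perp A n) (y_ i), hel (T := fun n => EE n) w) | i <- r].
exists c; split.
- by rewrite /cdegree all_map; apply: sub_all rP => i /= /eqP ->.
- move=> X b hb; have bl p : linear (fun u : cofps (subfam A) L p => b p k u w).
    by move=> a u v; exact: (bilPl hb).
  have Jl p : linear (fun u : fps L p => b p k (Jmap A u) w).
    by move=> a u v; rewrite Jmap_linear bl.
  rewrite (fps_sum Jl rP fE) /tsum /cembed !big_map; apply: eq_bigr => i _ /=.
  rewrite -[LHS]addr0 -(scale0r (b _ _ (pure (jdual A (g_ i)) (y_ i)) w)).
  symmetry; apply: (cofps_comb bl) => // s v.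
  by rewrite mul0r addr0; exact: Jmap_mul_perp.
move=> X b hb; have bl p : linear (fun u : cofps (subfam A) L p => b p k u w).
  by move=> a u v; exact: (bilPl hb).
have Jl p : linear (fun u : fps L p => b (p + 1) k (Jmap A (QL p u)) w).
  by move=> a u v; rewrite linearP Jmap_linear bl.
rewrite (fps_sum Jl rP fE) /cdiff_untwisted /cdiff !tsum_cat [tcomm [::] _]/= tsum_nil addr0.
rewrite /tsum !big_map -big_split; apply: eq_bigr => i _ /=.
rewrite (bilZl hb) -(cofps_comb bl _ _ (Jmap_Q_mul_perp QL_der QLA (g_ i) (y_ i))) //.
  by rewrite addrAC.
by rewrite addrA.
Qed.

(** [J] is a chain map on the kernel of [j]: the right-hand side is the
    evaluation of [J (Q_L x + [D, x])] for any lift [D] of [D^{A,E}], written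
    without a choice of lift. *)
Lemma cochain_of_kernel n x : tdegree n x -> jmap x =t [::] ->
  exists c : cochain A E, [/\ cdegree n c, JJ x =t cembed c &
    forall (X : lmodType K) (b : forall p q, OAL p -> EE q -> X), bilinear_family b ->
      tsum b (cdiff QL QA DAE c) = tsum b (JJ (QLmap x)) +
        tsum2 (lact_test b) DAE (JJ x) -
        koszul K 1 n *: tsum2 (ract_test b) (JJ x) DAE].
Proof.
move=> xn jx.
have [c [cn cJ cQ]] : exists c : cochain A E, [/\ cdegree n c,
    forall (X : lmodType K) (b : forall p q, OAL p -> EE q -> X), bilinear_family b ->
      tsum b (cembed c) = tsum b (JJ (kmap x)) &
    forall (X : lmodType K) (b : forall p q, OAL p -> EE q -> X), bilinear_family b ->
      tsum b (cdiff_untwisted c) = tsum b (JJ (QLmap (kmap x)))].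
  elim: x xn {jx} => [|[[p f] [q w]] x IH] /=; first by exists [::].
  case/andP=> /eqP pq /IH[c [cn cJ cQ]].
  have [c1 [c1n c1J c1Q]] := cochain_of_tensor w (jdual_kernel_part f).
  exists (c1 ++ c); split=> [|X b hb|X b hb].
  - by rewrite /cdegree all_cat -{1}pq [all _ c1]c1n.
  - rewrite /cembed map_cat tsum_cat [X in _ + X]cJ // [X in X + _]c1J //.
    by rewrite [RHS]/tsum big_cons.
  rewrite [RHS]/tsum big_cons -[X in _ = _ + X]cQ //= -[X in _ = X + _]c1Q //.
  rewrite /cdiff_untwisted /cdiff /tcomm /= !map_cat !cats0 !tsum_cat; exact: addrACA.
have Jx : JJ x =t cembed c.
  by move=> X b hb; rewrite cJ // (JJ_teq (kernel_part_teq jx) hb).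
exists c; split=> // X b hb.
rewrite tsum_cdiff_untwisted cQ // (tsum_tcomm hb (n := n) DAE1); last first.
  by move: cn; rewrite /cdegree /tdegree all_map.
have Q_linear p : linear (fun u : OL p => QL p u : OL (p + 1)).
  by move=> a u v; exact: linearP.
rewrite (JJ_teq (teq_map Q_linear (kernel_part_teq jx)) hb) addrA.
have tt (U W : int -> lmodType K) (y : tens U W) : y =t y by [].
rewrite (tsum2_teq (lact_quad hb) (tt _ _ DAE) Jx).
by rewrite (tsum2_teq (ract_quad hb) Jx (tt _ _ DAE)).
Qed.

End KernelTensors.

(** * Compatible deformations and gauge equivalences *)

Section Deformations.
Variables (K : fieldType) (L : int -> vectType K) (A : forall n, {vspace L n}).
Variables (QL : op1 L) (QA : op1 (subfam A)).
Hypothesis QLA : forall n (f : fps L n), jdual A (QL _ f) = QA _ (jdual A f).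

Lemma deformation_anticommutes Qp n (f : fps L n) :
  inf_deformation QL Qp -> QL _ (Qp _ f) = - Qp _ (QL _ f).
Proof.
case=> _ /(_ n (f, 0)) /(congr1 snd); rewrite /hext /= linear0 add0r.
by move/eqP; rewrite addr_eq0 => /eqP.
Qed.

Lemma compatible_jdual Qp n (f : fps L n) : A_compatible QL QA Qp -> jdual A (Qp _ f) = 0.
Proof.
case=> /(_ n (f, 0)) /(congr1 snd); rewrite /hmap /hext /= linear0 add0r => -> _.
have -> : jdual A (0 : fps L n) = 0 by apply: fps_eq.
by rewrite linear0.
Qed.

Lemma compatible_Jmap Qp n (x : perp A n) : A_compatible QL QA Qp -> Jmap A (Qp _ x) = 0.
Proof. by case=> _ /(_ n x) /(congr1 snd); rewrite /hmap /hext /= linear0 add0r. Qed.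

Section Gauge.
Variables (B : int -> vectType K) (p : forall n, {linear L n -> B n}).
Variable lam : forall n, {linear fps L n -> fps L n}.
Hypothesis lam_gauge : gauge A p lam.

(** The [hbar]-part of multiplicativity of [1 + hbar lam]. *)
Lemma gauge_leibniz m n (f : fps L m) (g : fps L n) s :
  lam _ (f \odot g) s = (lam _ f \odot g) s + koszul K 0 m * (f \odot lam _ g) s.
Proof.
have [_ [_ mult] _ _] := lam_gauge.
have : f \odot (0 : fps L n) + (0 : fps L m) \odot g + lam _ (f \odot g) =
    f \odot (0 + lam n g) + (0 + lam m f) \odot g.
  by have := congr1 snd (mult m n (f, 0) (g, 0)).
have -> : f \odot (0 : fps L n) = 0 by apply: fps_eq => t; exact: shuffle0r.
have -> : (0 : fps L m) \odot g = 0 by apply: fps_eq => t; exact: shuffle0l.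
rewrite !add0r => ->; rewrite /koszul mul0r expr0z mul1r; exact: addrC.
Qed.

Lemma gauge_jdual n (f : fps L n) : jdual A (lam _ f) = 0.
Proof.
case: lam_gauge => _ _ _ /(_ n (f, 0)) /(congr1 snd); rewrite /hmap /hext /= add0r => ->.
exact: fps_eq.
Qed.

Lemma gauge_perp n (x : perp A n) : quotient_map A p -> lam _ x = 0.
Proof.
move=> /(perp_pull x)[y <-].
case: lam_gauge => _ _ /(_ n (y, 0)) /(congr1 snd) + _; rewrite /hmap /hext /=.
have -> : pull p (0 : fps B n) = 0 by exact: fps_eq.
by rewrite add0r.
Qed.

Lemma gauge_commutes Qp Qp' n (f : fps L n) :
  (forall n (x : fps L n * fps L n),
     hext (fun f => f) (lam _) (hext (QL n) (Qp n) x) =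
     hext (QL n) (Qp' n) (hext (fun f => f) (lam n) x)) ->
  Qp _ f + lam _ (QL _ f) = QL _ (lam _ f) + Qp' _ f.
Proof. by move=> /(_ n (f, 0)) /(congr1 snd); rewrite /hext /= linear0 !add0r. Qed.

End Gauge.

End Deformations.

(** * Atiyah cocycles *)

Section Atiyah.
Variables (K : fieldType) (L : int -> vectType K) (A : forall n, {vspace L n}).
Variable E : int -> lmodType K.
Local Notation OA := (Oalg (subfam A)).
Local Notation OL := (Oalg L).
Local Notation OAL := (OWalg (subfam A) L).
Local Notation EE := (EndAlg E).
Local Notation jmap := (tmap (U := OL) (U' := OA) (W := EE) (@jdual K L A)).
Local Notation JJ := (tmap (U := OL) (U' := OAL) (W := EE) (@Jmap K L A)).
Local Notation omap Q := (tmap (U := OL) (U' := OL) (W := EE) Q).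

Lemma teq_refl (U W : int -> lmodType K) (x : tens U W) : x =t x.
Proof. by []. Qed.

Lemma teq_cat_nil (U W : int -> lmodType K) (x y : tens U W) :
  x =t [::] -> y =t [::] -> x ++ y =t [::].
Proof. by move=> x0 y0 X b hb; rewrite tsum_cat x0 // y0 // tsum_nil addr0. Qed.

Lemma jmap_mul x y : jmap (tmul x y) =t tmul (jmap x) (jmap y).
Proof.
move=> X b hb; rewrite tsum_map /tsum /tmul !big_allpairs_dep /tmap big_map.
apply: eq_bigr => s _; rewrite big_map; apply: eq_bigr => t _ /=.
by congr b; rewrite -jdualM; apply: fps_eq.
Qed.

Lemma jmap_sub x y z : jmap x =t z -> jmap y =t z -> jmap (x ++ tscale (-1) y) =t [::].
Proof.
move=> xz yz X b hb; rewrite tmap_cat tsum_cat xz //.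
rewrite (tmap_scale (fun n => @jdual_linear K L A n) _ _ hb) tsum_scale // yz //.
by rewrite scaleN1r subrr tsum_nil.
Qed.

Lemma tmul_teq (V : int -> vectType K) (x x' y y' : tens (Oalg V) EE) :
  x =t x' -> y =t y' -> tmul x y =t tmul x' y'.
Proof. by move=> xx yy X b hb; rewrite !tsum_mul; exact: (tsum2_teq (mul_test_quad hb)). Qed.

Lemma tmul_nill (V : int -> vectType K) (y : tens (Oalg V) EE) : tmul [::] y =t [::].
Proof. by []. Qed.

Lemma tmul_nilr (V : int -> vectType K) (x : tens (Oalg V) EE) : tmul x [::] =t [::].
Proof. by move=> X b hb; rewrite tsum_mul (tsum2_nilr (mul_test b)) tsum_nil. Qed.

Section Fixed.
Variables (QL : op1 L) (QA : op1 (subfam A)) (DAE : tens OA EE).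
Hypotheses (char0 : [pchar K] =i pred0) (finL : fin_dim L).
Hypothesis QL_hom : homological QL.
Hypothesis QA_der : derivation QA.
Hypothesis QLA : forall n (f : fps L n), jdual A (QL _ f) = QA _ (jdual A f).
Hypothesis hE : is_module QA DAE.

Section TestSums.
Variables (X : lmodType K) (b : forall p q, OAL p -> EE q -> X).
Hypothesis hb : bilinear_family b.
Local Notation t x := (tsum b (JJ x)).

Lemma JJ_cat x y : t (x ++ y) = t x + t y.
Proof. by rewrite tmap_cat tsum_cat. Qed.

Let bJ p q (u : OL p) (w : EE q) : X := b (Jmap A u : OAL p) w.
Let hbJ : bilinear_family bJ.
Proof. exact: (bilinear_map (fun p => @Jmap_linear K L A p) hb). Qed.
Let tE x : t x = tsum bJ x.
Proof. exact: tsum_map. Qed.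

Lemma JJ_mul_catl x x' y : t (tmul (x ++ x') y) = t (tmul x y) + t (tmul x' y).
Proof. by rewrite !tE !tsum_mul tsum2_catl. Qed.

Lemma JJ_mul_catr x y y' : t (tmul x (y ++ y')) = t (tmul x y) + t (tmul x y').
Proof. by rewrite !tE !tsum_mul tsum2_catr. Qed.

Lemma JJ_mulA x y z : t (tmul (tmul x y) z) = t (tmul x (tmul y z)).
Proof. by rewrite !tE; exact: tsum_mulA. Qed.

Lemma JJ_leibniz k d (T : forall n, {linear fps L n -> fps L (d n)}) n x y :
  (forall n, d n = n + k) ->
  (forall p q (f : fps L p) (g : fps L q) s,
     T _ (f \odot g) s = (T _ f \odot g) s + koszul K k p * (f \odot T _ g) s) ->
  tdegree n x ->
  t (omap T (tmul x y)) = t (tmul (omap T x) y) + koszul K k n *: t (tmul x (omap T y)).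
Proof. by move=> dE leib xn; rewrite !tE; exact: (tsum_leibniz dE leib hbJ). Qed.

Lemma JJ_mul_kernel x y : jmap x =t [::] -> jmap y =t [::] -> t (tmul x y) = 0.
Proof.
move=> jx jy; rewrite tsum_JJ_mul // (tsum2_teq (lact_quad hb) jx (@teq_refl _ _ _)).
by rewrite (tsum2_teq (ract_quad hb) (@teq_refl _ _ _) jy) tsum2_nill tsum2_nilr addr0.
Qed.

Lemma JJ_mul_lift x y : jmap x =t DAE -> jmap y =t [::] ->
  t (tmul x y) = tsum2 (lact_test b) DAE (JJ y) /\
  t (tmul y x) = tsum2 (ract_test b) (JJ y) DAE.
Proof.
move=> jx jy; rewrite !tsum_JJ_mul //.
rewrite (tsum2_teq (lact_quad hb) jx (@teq_refl _ _ _)).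
rewrite (tsum2_teq (ract_quad hb) (@teq_refl _ _ (JJ x)) jy) tsum2_nilr addr0.
rewrite (tsum2_teq (lact_quad hb) jy (@teq_refl _ _ _)) tsum2_nill add0r.
by rewrite (tsum2_teq (ract_quad hb) (@teq_refl _ _ _) jx).
Qed.

End TestSums.

Lemma koszul11 : koszul K 1 1 = -1. Proof. by []. Qed.
Lemma koszul12 : koszul K 1 2 = 1. Proof. by rewrite -[2]/(1 + 1) koszulDr koszul_sq. Qed.

Section Cocycle.
Variables (Qp : op1 L) (D : tens OL EE * tens OL EE).
Hypotheses (hQ : inf_deformation QL Qp) (hQA : A_compatible QL QA Qp).
Hypothesis hD : lift_of DAE D.

Lemma Jmap0 n : Jmap A (0 : fps L n) = 0.
Proof. by apply: cofps_eq. Qed.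

Lemma JJ_compatible x : jmap x =t [::] -> JJ (omap Qp x) =t [::].
Proof.
apply: JJ_kernel => n f.
apply: (Jmap_kernel hQ.1 char0 finL) => m g.
  exact: compatible_jdual hQA.
exact: compatible_Jmap hQA.
Qed.

(** At order zero [j R] is the curvature of [D^{A,E}]; at first order every term
    contains [j D_2] or [j Q_+], which are zero. *)
Lemma jmap_curvature : jmap (curvature QL Qp D).1 =t [::] /\ jmap (curvature QL Qp D).2 =t [::].
Proof.
case: hD => _ _ jD1 jD2.
have QA_linear p : linear (fun u : OA p => QA p u : OA (p + 1)).
  by move=> a u v; exact: linearP.
have jQ x : jmap (omap QL x) =t tmap QA (jmap x).
  by move=> X b hb; rewrite !tsum_map; apply: eq_bigr => s _; rewrite QLA.
rewrite !tmap_cat; split.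
  apply: teq_trans (module_flat QA_der hE) => X b hb; rewrite !tsum_cat; congr (_ + _).
    by rewrite (jQ _ _ _ hb) (teq_map QA_linear jD1 hb).
  by rewrite (jmap_mul _ _ hb) (tmul_teq jD1 jD1 hb).
apply: teq_cat_nil; last apply: teq_cat_nil; last apply: teq_cat_nil.
- exact: teq_trans (jQ _) (teq_map QA_linear jD2).
- move=> X b hb; rewrite !tsum_map tsum_nil /tsum big1 // => s _.
  by rewrite (compatible_jdual _ hQA) (bil0l hb).
- exact: teq_trans (jmap_mul _ _) (teq_trans (tmul_teq jD1 jD2) (tmul_nilr _)).
exact: teq_trans (jmap_mul _ _) (teq_trans (tmul_teq jD2 jD1) (tmul_nill _)).
Qed.

Lemma tdegree_curvature :
  tdegree 2 (curvature QL Qp D).1 /\ tdegree 2 (curvature QL Qp D).2.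
Proof.
case: hD => d1 d2 _ _; split; rewrite /curvature /=;
  by do ! [apply: tdegree_cat | exact: (tdegree_map (k := 1))
          | exact: (tdegree_mul (m := 1) (n := 1))].
Qed.

(** The identity [Q(hbar) R + [D, R] = 0] for [D = D.1 + hbar D.2].  Its
    first-order part also contains [Q_+ R.1 + D.2 R.1 - R.1 D.2], which [J]
    annihilates: [R.1] and [D.2] lie in the kernel of [j]. *)
Lemma bianchi (X : lmodType K) (b : forall p q, OAL p -> EE q -> X) (hb : bilinear_family b) :
  let R := curvature QL Qp D in
  tsum b (JJ (omap QL R.1)) + tsum b (JJ (tmul D.1 R.1)) = tsum b (JJ (tmul R.1 D.1)) /\
  tsum b (JJ (omap QL R.2)) + tsum b (JJ (tmul D.1 R.2)) = tsum b (JJ (tmul R.2 D.1)).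
Proof.
case: hD => d1 d2 jD1 jD2 R; have [jR1 _] := jmap_curvature.
have QQ x : tsum b (JJ (omap QL (omap QL x))) = 0.
  by rewrite !tsum_map /tsum big1 // => s _; rewrite QL_hom.2 Jmap0 (bil0l hb).
have QQp x : tsum b (JJ (omap QL (omap Qp x))) = - tsum b (JJ (omap Qp (omap QL x))).
  rewrite !tsum_map /tsum -sumrN; apply: eq_bigr => s _.
  rewrite (deformation_anticommutes _ hQ) -scaleN1r.
  have bJ u w : b _ _ (Jmap A (-1 *: u)) w = - b _ _ (Jmap A u) w.
    rewrite -[_ *: u]addr0 Jmap_linear Jmap0 addr0 -scaleN1r; exact: (bilZl hb).
  exact: bJ.
split.
  rewrite /R /curvature /= tmap_cat JJ_cat QQ add0r.
  rewrite (JJ_leibniz hb _ (fun n => erefl _) QL_hom.1 d1) koszul11 scaleN1r.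
  rewrite JJ_mul_catr JJ_mul_catl (JJ_mulA hb).
  by rewrite addrA subrK.
have E1 : tsum b (JJ (omap Qp (omap QL D.1))) =
    tsum b (JJ (tmul D.1 (omap Qp D.1))) - tsum b (JJ (tmul (omap Qp D.1) D.1)).
  apply/eqP; rewrite -subr_eq0 opprB addrA; apply/eqP.
  have := JJ_compatible jR1 hb; rewrite tsum_nil /curvature /= tmap_cat JJ_cat.
  by rewrite (JJ_leibniz hb _ (fun n => erefl _) hQ.1 d1) koszul11 scaleN1r addrA.
have E2 : tsum b (JJ (tmul (omap QL D.1) D.2)) = - tsum b (JJ (tmul D.1 (tmul D.1 D.2))).
  have := JJ_mul_kernel hb jR1 jD2; rewrite JJ_mul_catl (JJ_mulA hb).
  by move/eqP; rewrite addr_eq0 => /eqP.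
have E3 : tsum b (JJ (tmul D.2 (omap QL D.1))) = - tsum b (JJ (tmul D.2 (tmul D.1 D.1))).
  have := JJ_mul_kernel hb jD2 jR1; rewrite JJ_mul_catr.
  by move/eqP; rewrite addr_eq0 => /eqP.
rewrite /R /curvature /= !tmap_cat !tsum_cat QQ add0r QQp.
rewrite (JJ_leibniz hb _ (fun n => erefl _) QL_hom.1 d1) koszul11 scaleN1r.
rewrite (JJ_leibniz hb _ (fun n => erefl _) QL_hom.1 d2) koszul11 scaleN1r.
rewrite !JJ_mul_catr !JJ_mul_catl !(JJ_mulA hb) E1 E2 E3.
rewrite opprB opprK.
(* Three pairs of opposite terms cancel, the others agree on both sides. *)
rewrite [LHS](AC ((2*(2*2))*(1*(1*2))) ((5*(1*(10*6)))*(8*2)*(9*3)*(7*4))) /=.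
by rewrite !subrr !addr0.
Qed.

Lemma atiyah_cocycle : cocycle2 QL QA DAE (atiyah A QL Qp D).
Proof.
have [j1 j2] := jmap_curvature; have [r1 r2] := tdegree_curvature.
have [c1 [c1n c1J c1d]] := cochain_of_kernel char0 finL QL_hom.1 QLA hE.1 r1 j1.
have [c2 [c2n c2J c2d]] := cochain_of_kernel char0 finL QL_hom.1 QLA hE.1 r2 j2.
case: hD => _ _ jD1 _.
exists (c1, c2); split=> //; split=> X b hb; rewrite tsum_nil ?c1d ?c2d //.
  have [<- <-] := JJ_mul_lift hb jD1 j1.
  by rewrite koszul12 scale1r (bianchi hb).1 subrr.
have [<- <-] := JJ_mul_lift hb jD1 j2.
by rewrite koszul12 scale1r (bianchi hb).2 subrr.
Qed.

End Cocycle.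

Section Comparison.
Variables (X : lmodType K) (b : forall p q, OAL p -> EE q -> X).
Hypothesis hb : bilinear_family b.
Local Notation t x := (tsum b (JJ x)).

(** The evaluation of [J (Q_L x) + D^{A,E} . J x + J x . D^{A,E}].  It makes
    sense for all [x], and on elements of degree 1 of the kernel of [j] it is the
    differential of [J x]. *)
Definition coboundary_sum x : X :=
  t (omap QL x) + tsum2 (lact_test b) DAE (JJ x) + tsum2 (ract_test b) (JJ x) DAE.

Lemma coboundary_sum_cat x y :
  coboundary_sum (x ++ y) = coboundary_sum x + coboundary_sum y.
Proof.
rewrite /coboundary_sum !tmap_cat tsum_cat tsum2_catl tsum2_catr.
by rewrite [RHS]addrACA; congr (_ + _); exact: addrACA.
Qed.

Lemma coboundary_sum_opp x : coboundary_sum (tscale (-1) x) = - coboundary_sum x.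
Proof.
have JS c y : JJ (tscale c y) =t tscale c (JJ y).
  by apply: tmap_scale => p; exact: Jmap_linear.
have QS c y : omap QL (tscale c y) =t tscale c (omap QL y).
  by apply: tmap_scale => n a u v; exact: linearP.
rewrite /coboundary_sum (JJ_teq (QS _ _) hb) (JS _ _ _ _ hb) tsum_scale //.
rewrite (tsum2_teq (lact_quad hb) (@teq_refl _ _ _) (JS _ _)).
rewrite (tsum2_teq (ract_quad hb) (JS _ _) (@teq_refl _ _ _)).
rewrite (tsum2_scaler (lact_quad hb)) (tsum2_scalel (ract_quad hb)).
by rewrite !scaleN1r !opprD.
Qed.

Lemma coboundary_sum_kernel y x : jmap y =t DAE -> jmap x =t [::] ->
  coboundary_sum x = t (omap QL x) + t (tmul y x) + t (tmul x y).
Proof. by move=> jy jx; have [-> ->] := JJ_mul_lift hb jy jx. Qed.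

Lemma atiyah_sum Qp D : lift_of DAE D ->
  tsum b (atiyah A QL Qp D).1 = coboundary_sum D.1 /\
  tsum b (atiyah A QL Qp D).2 = coboundary_sum D.2 + t (omap Qp D.1).
Proof.
case=> _ _ jD1 jD2; rewrite /atiyah /hmap /curvature /=; split.
  rewrite tmap_cat tsum_cat tsum_JJ_mul // /coboundary_sum addrA.
  rewrite (tsum2_teq (lact_quad hb) jD1 (@teq_refl _ _ _)).
  by rewrite (tsum2_teq (ract_quad hb) (@teq_refl _ _ _) jD1).
rewrite !tmap_cat !tsum_cat (coboundary_sum_kernel jD1 jD2) addrCA addrC.
by rewrite addrA.
Qed.

Lemma compatible_kernel_sum Qp x y : inf_deformation QL Qp -> A_compatible QL QA Qp ->
  jmap x =t jmap y -> t (omap Qp x) = t (omap Qp y).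
Proof.
move=> hQ hQA xy.
have QS c z : omap Qp (tscale c z) =t tscale c (omap Qp z).
  by apply: tmap_scale => n a u v; exact: linearP.
have JS c z : JJ (tscale c z) =t tscale c (JJ z).
  by apply: tmap_scale => n; exact: Jmap_linear.
have kill : jmap (x ++ tscale (-1) y) =t [::] by exact: jmap_sub xy (@teq_refl _ _ _).
have := JJ_compatible hQ hQA kill hb.
rewrite !tmap_cat tsum_cat (JJ_teq (QS _ _) hb) (JS _ _ _ _ hb) tsum_scale //.
by rewrite tsum_nil scaleN1r => /eqP; rewrite subr_eq0 => /eqP.
Qed.

(** By the gauge relation the two sides differ, up to sign, by [J (lam R)], where
    [R] is the order-zero curvature [Q_L D.1 + D.1 D.1]: the products [D.1 . lam D.1 + lam D.1 . D.1] in [coboundary_sum] are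
    [lam (D.1 D.1)].  This vanishes because [R] is in the kernel of [j]. *)
Lemma gauge_sum (B : int -> vectType K) (p : forall n, {linear L n -> B n})
    (lam : forall n, {linear fps L n -> fps L n}) (Qp Qp' : op1 L) D :
  quotient_map A p -> gauge A p lam ->
  (forall n (f : fps L n), Qp _ f + lam _ (QL _ f) = QL _ (lam _ f) + Qp' _ f) ->
  A_compatible QL QA Qp -> lift_of DAE D ->
  t (omap Qp D.1) = t (omap Qp' D.1) + coboundary_sum (omap lam D.1).
Proof.
move=> hB lam_gauge lamQ hQA hD; have [d1 _ jD1 _] := hD.
have jlam : jmap (omap lam D.1) =t [::].
  move=> Y c hc; rewrite !tsum_map tsum_nil /tsum big1 // => s _.
  by rewrite (gauge_jdual lam_gauge) (bil0l hc).
have lam_kernel n (f : fps L n) : jdual A f = 0 -> Jmap A (lam n f) = 0.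
  apply: (Jmap_kernel (gauge_leibniz lam_gauge) char0 finL) => [m g|m x].
    exact: (gauge_jdual lam_gauge).
  by rewrite (gauge_perp lam_gauge) ?Jmap0.
have := JJ_kernel lam_kernel (jmap_curvature hQA hD).1 hb.
rewrite tsum_nil /curvature /= tmap_cat JJ_cat.
rewrite (JJ_leibniz hb _ (fun n => esym (addr0 n)) (gauge_leibniz lam_gauge) d1).
rewrite {1}/koszul mul0r expr0z scale1r => kill.
have comm : t (omap Qp D.1) + t (omap lam (omap QL D.1)) =
    t (omap QL (omap lam D.1)) + t (omap Qp' D.1).
  rewrite !tsum_map /tsum -!big_split; apply: eq_bigr => s _ /=.
  rewrite -[LHS](bilDl hb) -[RHS](bilDl hb).
  have JD n (u v : fps L n) : Jmap A (u + v) = Jmap A u + Jmap A v by apply: cofps_eq.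
  by rewrite -!JD lamQ.
rewrite (coboundary_sum_kernel jD1 jlam) -[LHS]addr0 -kill addrA comm.
by rewrite [RHS](AC (1*3) ((2*1)*(4*3))).
Qed.

End Comparison.
End Fixed.
End Atiyah.

Theorem mainTheorem3 (K : fieldType) (char0 : [pchar K] =i pred0)
  (L : int -> vectType K) (finL : fin_dim L)
  (A : forall n, {vspace L n})
  (B : int -> vectType K) (p : forall n, {linear L n -> B n})
  (hB : quotient_map A p)
  (QL : op1 L) (QA : op1 (subfam A)) (hLA : SHLie_pair QL QA)
  (E : int -> lmodType K) (DAE : tens (Oalg (subfam A)) (EndAlg E))
  (hE : is_module QA DAE)
  (Qp Qp' : op1 L)
  (hQ : inf_deformation QL Qp) (hQA : A_compatible QL QA Qp)
  (hQ' : inf_deformation QL Qp') (hQA' : A_compatible QL QA Qp')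
  (hgauge : gauge_equivalent A p QL Qp Qp')
  (D D' : tens (Oalg L) (EndAlg E) * tens (Oalg L) (EndAlg E))
  (hD : lift_of DAE D) (hD' : lift_of DAE D') :
  same_class2 QL QA DAE (atiyah A QL Qp D) (atiyah A QL Qp' D').
Proof.
have [QL_hom _ [QA_der _] QLA] := hLA; have [lam lam_gauge lamQ] := hgauge.
split; [exact: atiyah_cocycle|exact: atiyah_cocycle|].
have [d1 d2 jD1 jD2] := hD; have [d1' d2' jD1' jD2'] := hD'.
pose j_ := tmap (U := Oalg L) (U' := Oalg (subfam A)) (W := EndAlg E) (@jdual K L A).
pose lam_ := tmap (U := Oalg L) (U' := Oalg L) (W := EndAlg E) lam.
(* The cobounding cochains are [J x1] and [J x2]. *)
pose x1 := D.1 ++ tscale (-1) D'.1.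
pose x2 := D.2 ++ tscale (-1) D'.2 ++ lam_ D.1.
have jlam : j_ (lam_ D.1) =t [::].
  move=> X b hb; rewrite !tsum_map tsum_nil /tsum big1 // => s _.
  by rewrite (gauge_jdual lam_gauge) (bil0l hb).
have jx1 : j_ x1 =t [::] by exact: jmap_sub jD1 jD1'.
have jx2 : j_ x2 =t [::].
  rewrite /x2 catA /j_ tmap_cat; apply: teq_cat_nil => //; exact: jmap_sub jD2 jD2'.
have x1d : tdegree 1 x1 by apply: tdegree_cat => //; exact: tdegree_scale.
have x2d : tdegree 1 x2.
  apply: tdegree_cat => //; apply: tdegree_cat; first exact: tdegree_scale.
  by rewrite -[1]addr0; apply: tdegree_map => // n; rewrite addr0.
have [b1 [b1n _ b1d]] := cochain_of_kernel char0 finL QL_hom.1 QLA hE.1 x1d jx1.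
have [b2 [b2n _ b2d]] := cochain_of_kernel char0 finL QL_hom.1 QLA hE.1 x2d jx2.
exists (b1, b2); split=> // X b hb; rewrite tsum_cat ?b1d ?b2d // koszul11 scaleN1r opprK.
  rewrite (atiyah_sum QL hb Qp hD).1 (atiyah_sum QL hb Qp' hD').1.
  rewrite -/(coboundary_sum QL DAE b x1) coboundary_sum_cat coboundary_sum_opp //.
  by rewrite addrC subrK.
rewrite (atiyah_sum QL hb Qp hD).2 (atiyah_sum QL hb Qp' hD').2.
rewrite (gauge_sum char0 finL QA_der QLA hE hb hB lam_gauge _ hQA hD (Qp' := Qp')); last first.
  by move=> n f; exact: (gauge_commutes f lamQ).
have jDD : j_ D.1 =t j_ D'.1 by exact: teq_trans jD1 (teq_sym jD1').
rewrite (compatible_kernel_sum char0 finL hb hQ' hQA' jDD).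
rewrite -/(coboundary_sum QL DAE b x2) !coboundary_sum_cat coboundary_sum_opp //.
rewrite [RHS](AC (2*(1*2)) ((3*(2*5))*(1*4))) /=.
by rewrite subrr addr0.
Qed.
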